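(* Let $\rho>0$, let $\mathcal{X}\subseteq\mathbb{R}^d$ be a nonempty closed convex set, let $f\colon\mathbb{R}^d\to\mathbb{R}$ be $\rho$-weakly convex, and set $\varphi=f+\delta_{\mathcal{X}}$, where $\delta_{\mathcal{X}}$ is the indicator function of $\mathcal{X}$ ($0$ on $\mathcal{X}$, $+\infty$ off $\mathcal{X}$). Suppose the stochastic subgradient oracle satisfies: (A1) one can generate i.i.d. realizations $\xi_0,\xi_1,\ldots\sim P$ from a probability space $(\Omega,\mathcal{F},P)$; (A2) there is an open set $U\supseteq\mathcal{X}$ and a measurable map $G\colon U\times\Omega\to\mathbb{R}^d$ with $\mathbb{E}_\xi[G(x,\xi)]\in\partial f(x)$ for all $x\in U$; (A3) there is $L\ge 0$ with $\mathbb{E}_\xi\|G(x,\xi)\|^2\le L^2$ for all $x\in\mathcal{X}$. Fix $T\ge 0$, $x_0\in\mathcal{X}$ and stepsizes $\alpha_0,\ldots,\alpha_T\ge 0$ with $\sum_{t=0}^T\alpha_t>0$. Define $x_{t+1}=\mathrm{proj}_{\mathcal{X}}\big(x_t-\alpha_t G(x_t,\xi_t)\big)$ for $t=0,\ldots,T$, and let $t^*\in\{0,\ldots,T\}$ be sampled (independently of the $\xi_t$) with $\mathbb{P}(t^*=t)=\alpha_t/\sum_{i=0}^T\alpha_i$. Then for every $\bar\rho>\rho$ and every $t\in\{0,\ldots,T\}$, $$\mathbb{E}\big[\varphi_{1/\bar\rho}(x_{t+1})\big]\le \mathbb{E}\big[\varphi_{1/\bar\rho}(x_t)\big]-\frac{\alpha_t(\bar\rho-\rho)}{\bar\rho}\,\mathbb{E}\big[\|\nabla\varphi_{1/\bar\rho}(x_t)\|^2\big]+\frac{\alpha_t^2\bar\rho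 L^2}{2},$$ and $$\mathbb{E}\big[\|\nabla\varphi_{1/\bar\rho}(x_{t^*})\|^2\big]\le\frac{\bar\rho}{\bar\rho-\rho}\cdot\frac{\big(\varphi_{1/\bar\rho}(x_0)-\min\varphi\big)+\frac{\bar\rho L^2}{2}\sum_{t=0}^T\alpha_t^2}{\sum_{t=0}^T\alpha_t}.$$ In particular, if $\alpha_t=\gamma/\sqrt{T+1}$ for all $t$, for some real $\gamma>0$, then $$\mathbb{E}\big[\|\nabla\varphi_{1/(2\rho)}(x_{t^*})\|^2\big]\le 2\cdot\frac{\big(\varphi_{1/(2\rho)}(x_0)-\min\varphi\big)+\rho L^2\gamma^2}{\gamma\sqrt{T+1}}.$$
   Context: For $\varphi\colon\mathbb{R}^d\to\mathbb{R}\cup\{+\infty\}$ and $x$ with $\varphi(x)$ finite, the subdifferential $\partial\varphi(x)$ is the set of $v\in\mathbb{R}^d$ with $\varphi(y)\ge\varphi(x)+\langle v,y-x\rangle+o(\|y-x\|)$ as $y\to x$. A function $g$ is $\rho$-weakly convex if $x\mapsto g(x)+\frac{\rho}{2}\|x\|^2$ is convex. For $\lambda>0$, the Moreau envelope is $\varphi_\lambda(x)=\min_y\{\varphi(y)+\frac{1}{2\lambda}\|y-x\|^2\}$ and the proximal map is $\mathrm{prox}_{\lambda\varphi}(x)=\operatorname{argmin}_y\{\varphi(y)+\frac{1}{2\lambda}\|y-x\|^2\}$; when $\varphi$ is $\rho$-weakly convex and lower semicontinuous and $0<\lambda<\rho^{-1}$, $\varphi_\lambda$ is $C^1$ with $\nabla\varphi_\lambda(x)=\lambda^{-1}(x-\mathrm{prox}_{\lambda\varphi}(x))$.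 $\min\varphi$ denotes $\inf_x\varphi(x)$. $\mathrm{proj}_{\mathcal{X}}$ is the Euclidean nearest-point projection. $\mathbb{E}$ denotes expectation over all randomness ($\xi_0,\xi_1,\ldots$ and $t^*$). *)

(* Defs.v *)
From HB Require Import structures.
From mathcomp Require Import all_boot all_order all_algebra.
From mathcomp Require Import all_classical all_reals all_analysis.
Set Implicit Arguments. Unset Strict Implicit. Unset Printing Implicit Defensive.
Import Order.TTheory GRing.Theory Num.Theory.
Import numFieldNormedType.Exports.
Local Open Scope classical_set_scope.
Local Open Scope ring_scope.

Section Defs.
Variables (R : realType) (d : nat).
Notation vec := 'rV[R]_d.

Definition inner (u v : vec) : R := \sum_(i < d) u 0 i * v 0 i.
Definition enorm (u : vec) : R := Num.sqrt (inner u u).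

Definition convex_set_of (X : set vec) : Prop :=
  forall x y (t : R), X x -> X y -> 0 <= t <= 1 -> X (t *: x + (1 - t) *: y).

Definition convex_fun (g : vec -> R) : Prop :=
  forall x y (t : R), 0 <= t <= 1 ->
    g (t *: x + (1 - t) *: y) <= t * g x + (1 - t) * g y.

Definition weakly_convex (rho : R) (g : vec -> R) : Prop :=
  convex_fun (fun x => g x + rho / 2 * enorm x ^+ 2).

(* (Frechet/regular) subdifferential of a real-valued function:
   g y >= g x + <v, y - x> + o(||y - x||) as y -> x. *)
Definition subdiff (g : vec -> R) (x v : vec) : Prop :=
  forall eps : R, 0 < eps -> exists2 delta : R, 0 < delta &
    forall y, enorm (y - x) < delta ->
      g x + inner v (y - x) - eps * enorm (y - x) <= g y.

Definition phi_of (f : vec -> R) (X : set vec) (y : vec) : \bar R :=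
  if `[< X y >] then (f y)%:E else +oo%E.

Definition min_ext (phi : vec -> \bar R) : \bar R := ereal_inf (range phi).

(* Moreau envelope phi_lam(x) = min_y {phi y + ||y - x||^2/(2 lam)}
   (finite in the regime considered; returned as a real via fine). *)
Definition moreau (phi : vec -> \bar R) (lam : R) (x : vec) : R :=
  fine (ereal_inf [set (phi y + (enorm (y - x) ^+ 2 / (2 * lam))%:E)%E | y in setT]).

Definition grad (F : vec -> R) (x : vec) : vec :=
  \row_(i < d) ('D_(delta_mx 0 i : vec) F x).

Definition is_proj (X : set vec) (z p : vec) : Prop :=
  X p /\ forall q, X q -> enorm (p - z) <= enorm (q - z).

Definition borel_vec : set (set vec) := <<s [set A | open A] >>.

Definition jointly_measurable {dO} {Omega : measurableType dO}
    (U : set vec) (G : vec -> Omega -> vec) : Prop :=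
  forall B, borel_vec B ->
    <<s [set A `*` C | A in borel_vec & C in measurable] >>
      ((U `*` setT) `&` [set p | B (G p.1 p.2)]).

Definition rv_measurable {dO} {Omega : measurableType dO} (Y : Omega -> vec) : Prop :=
  forall B, borel_vec B -> measurable (Y @^-1` B).
End Defs.

(* Main.v *)
Require Import Defs.
From HB Require Import structures.
From mathcomp Require Import all_boot all_order all_algebra.
From mathcomp Require Import all_classical all_reals all_analysis.
From mathcomp Require Import measurable_realfun ring lra.
Import Order.TTheory GRing.Theory Num.Theory.
Import numFieldNormedType.Exports.
Local Open Scope classical_set_scope.
Local Open Scope ring_scope.

(* Let p be the proximal point of x_t.  Since p lies in X and the projection is
   nonexpansive, the envelope at x_{t+1} is at most
   f p + rb / 2 * |x_t - alpha_t G(x_t, xi_t) - p|^2.  Given x_t, the mean of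
   the square is |x_t - p|^2 - 2 alpha_t <v, x_t - p> + alpha_t^2 E|G|^2 with v a
   subgradient of f at x_t; weak convexity together with the strong convexity of
   the proximal objective gives <v, x_t - p> >= (rb - rho) |x_t - p|^2, and
   rb (x_t - p) is the gradient of the envelope.  Telescoping over t gives the
   second bound.

   x_t depends on xi_0, ..., xi_{t-1} only, so it is independent of xi_t and of
   t^*.  As the square is nonnegative, conditioning on x_t is an application of
   Tonelli's theorem to the joint law of (x_t, xi_t).  Subgradients at the points
   of X replace the continuity of f: they give the lower semicontinuity and the
   quadratic minorants needed for the existence of proximal points. *)

Set Implicit Arguments.
Unset Strict Implicit.
Unset Printing Implicit Defensive.

(** * Algebra of the Euclidean inner product and comparison with the sup norm *)

Section InnerProduct.
Context {R : realType} {d : nat}.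
Implicit Types (u v w x y z : 'rV[R]_d) (a : R).

Lemma innerC u v : inner u v = inner v u.
Proof. by apply: eq_bigr => i _; rewrite mulrC. Qed.

Lemma innerDl u v w : inner (u + v) w = inner u w + inner v w.
Proof. by rewrite /inner -big_split; apply: eq_bigr => i _; rewrite mxE mulrDl. Qed.

Lemma innerZl a u v : inner (a *: u) v = a * inner u v.
Proof. by rewrite /inner mulr_sumr; apply: eq_bigr => i _; rewrite mxE mulrA. Qed.

Lemma innerNl u v : inner (- u) v = - inner u v.
Proof. by rewrite -scaleN1r innerZl mulN1r. Qed.

Lemma innerDr u v w : inner w (u + v) = inner w u + inner w v.
Proof. by rewrite innerC innerDl !(innerC w). Qed.

Lemma innerZr a u v : inner v (a *: u) = a * inner v u.
Proof. by rewrite innerC innerZl innerC. Qed.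

Lemma innerNr u v : inner v (- u) = - inner v u.
Proof. by rewrite innerC innerNl innerC. Qed.

Lemma inner0r v : inner v 0 = 0.
Proof. by rewrite -(scale0r 0) innerZr mul0r. Qed.

Lemma inner_ge0 u : 0 <= inner u u.
Proof. by apply: sumr_ge0 => i _; rewrite -expr2 sqr_ge0. Qed.

Lemma enormK u : enorm u ^+ 2 = inner u u.
Proof. by rewrite sqr_sqrtr// inner_ge0. Qed.

Definition innerE :=
  (innerDl, innerDr, innerNl, innerNr, innerZl, innerZr).

Lemma inner_coord_sqr u i : u 0 i ^+ 2 <= inner u u.
Proof.
rewrite /inner (bigD1 i)//= -expr2 lerDl.
by apply: sumr_ge0 => j _; rewrite -expr2 sqr_ge0.
Qed.

Lemma coord_norm_le u i : `|u 0 i| <= `|u|.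
Proof.
rewrite [leRHS]/Num.norm /= mx_normrE.
exact: (le_bigmax _ (fun ij : 'I_1 * 'I_d => `|u ij.1 ij.2|) (0, i)).
Qed.

(** The topology on row vectors is that of the sup norm; this bound and [norm_le_inner] transfer
    limits between it and the Euclidean length. *)
Lemma inner_le_norm u : inner u u <= d%:R * `|u| ^+ 2.
Proof.
rewrite mulr_natl -[X in _ *+ X]card_ord -sumr_const.
apply: ler_sum => i _; rewrite -expr2 -real_normK ?num_real//.
by rewrite lerXn2r ?nnegrE// coord_norm_le.
Qed.

Lemma norm_le_inner u : `|u| ^+ 2 <= inner u u.
Proof.
have [->|u0] := eqVneq `|u| 0; first by rewrite expr0n inner_ge0.
have [[i j] /= E] := mx_norm_neq0 u0.
have -> : `|u| = `|u i j| := E; rewrite real_normK ?num_real//.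
by rewrite ord1 inner_coord_sqr.
Qed.

Lemma inner_norm_le u v : `|inner u v| <= (\sum_i `|u 0 i|) * `|v|.
Proof.
rewrite mulr_suml (le_trans (ler_norm_sum _ _ _))//; apply: ler_sum => i _.
by rewrite normrM ler_wpM2l// coord_norm_le.
Qed.

(** Young's inequality: nonnegativity of the squares of [u + v] and [u - v] gives the two signs. *)
Lemma inner_bound u v : `|inner u v| <= (inner u u + inner v v) / 2.
Proof.
have := inner_ge0 (u + v); have := inner_ge0 (u - v).
rewrite !innerE (innerC v u) => h1 h2.
by rewrite ler_norml; apply/andP; split; lra.
Qed.

Lemma inner_delta u i : inner u (delta_mx 0 i) = u 0 i.
Proof.
rewrite /inner (bigD1 i)//= mxE !eqxx mulr1 big1 ?addr0// => j ji.
by rewrite mxE (negbTE ji) andbF mulr0.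
Qed.

Lemma inner_eq0 u : inner u u <= 0 -> u = 0.
Proof.
move=> u0; apply/rowP => i; rewrite mxE; apply/eqP.
by rewrite -sqrf_eq0 eq_le sqr_ge0 andbT (le_trans (inner_coord_sqr u i)).
Qed.

End InnerProduct.

(** This replaces the passage to the limit [t -> 0] in the convexity arguments. The witness uses
    [K + 1] so that the division is legitimate when [K = 0]. *)
Lemma ler_vanishing {R : realType} (A B K : R) : 0 <= K ->
  (forall t, 0 < t <= 1 -> A - t * K <= B) -> A <= B.
Proof.
move=> K0 H; apply/ler_addgt0Pr => e e0.
have K1 : 0 < K + 1 by rewrite ltr_wpDl.
pose t := Num.min 1 (e / (K + 1)).
have t0 : 0 < t by rewrite lt_min ltr01 divr_gt0.
have tK : t * K <= e.
  have : t <= e / (K + 1) by rewrite ge_min lexx orbT.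
  rewrite ler_pdivlMr// mulrDr mulr1 => /(le_trans _); apply.
  by rewrite lerDl ltW.
have : 0 < t <= 1 by rewrite t0 ge_min lexx.
by move=> /H; lra.
Qed.

(** * Weak convexity and global subgradient inequalities *)

Section WeakConvexity.
Context {R : realType} {d : nat} (rho : R) (f : 'rV[R]_d -> R).
Hypothesis rho_ge0 : 0 <= rho.
Hypothesis f_wc : weakly_convex rho f.

(** The last term is the defect of the square: t|x|^2 + (1-t)|y|^2 - |tx + (1-t)y|^2 =
    t(1-t)|x-y|^2. *)
Lemma weakly_convex_ineq x y (t : R) : 0 <= t <= 1 ->
  f (t *: x + (1 - t) *: y) <= t * f x + (1 - t) * f y
     + rho / 2 * t * (1 - t) * inner (x - y) (x - y).
Proof.
move=> t01; have := f_wc x y t01.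
rewrite !enormK !innerE (innerC y x) => h.
set A := f _ in h *; set a := inner x x in h *; set b := inner y y in h *.
set c := inner x y in h *; nra.
Qed.

(** From local to global: the local inequality is applied at a point of the segment close to [x],
    weak convexity bounds [f] there from above, and division by [t] leaves the inequality at [y]. *)
Lemma subdiff_ineq x v y : subdiff f x v ->
  f x + inner v (y - x) - rho / 2 * inner (y - x) (y - x) <= f y.
Proof.
move=> fxv.
set N := inner (y - x) (y - x); set I := inner v (y - x).
have N0 : 0 <= N by exact: inner_ge0.
apply/ler_addgt0Pr => e e0.
have E0 : 0 <= enorm (y - x) by rewrite sqrtr_ge0.
have E1 : 0 < enorm (y - x) + 1 by rewrite ltr_wpDl.
have [delta delta0 H] := fxv (e / (enorm (y - x) + 1)) (divr_gt0 e0 E1).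
(* This [t] brings the point of the segment within [delta] of [x]; the factor 1/2 makes the
   inequality strict. The slack [e / (enorm (y - x) + 1)] was chosen so that the little-o term costs
   at most [t * e]. *)
pose t := Num.min 1 (delta / 2 / (enorm (y - x) + 1)).
have t0 : 0 < t by rewrite lt_min ltr01 !divr_gt0.
have t1 : t <= 1 by rewrite ge_min lexx.
have t01 : 0 <= t <= 1 by rewrite (ltW t0).
have tE : t * enorm (y - x) < delta.
  have : t <= delta / 2 / (enorm (y - x) + 1) by rewrite ge_min lexx orbT.
  by rewrite ler_pdivlMr// => h; nra.
have ytE : t *: y + (1 - t) *: x - x = t *: (y - x).
  by rewrite scalerBl scale1r scalerBr addrA addrAC addrK.
have Et : enorm (t *: (y - x)) = t * enorm (y - x).
  rewrite /enorm innerZl innerZr mulrA -expr2 sqrtrM ?sqr_ge0//.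
  by rewrite sqrtr_sqr ger0_norm// ltW.
have := H (t *: y + (1 - t) *: x); rewrite ytE Et innerZr => /(_ tE) h1.
have h2 := weakly_convex_ineq y x t01.
have eE : e / (enorm (y - x) + 1) * enorm (y - x) <= e.
  by rewrite -mulrAC ler_pdivrMr// ler_wpM2l ?(ltW e0)// lerDl.
rewrite -(ler_pM2l t0).
have h3 := le_trans h1 h2; rewrite -/N -/I in h3.
have h4 : t * (e / (enorm (y - x) + 1) * enorm (y - x)) <= t * e.
  by rewrite ler_pM2l.
have h5 : 0 <= rho / 2 * t ^+ 2 * N.
  by do !apply: mulr_ge0; rewrite ?invr_ge0 ?ler0n ?exprn_ge0 ?(ltW t0).
nra.
Qed.

End WeakConvexity.

(** * Proximal points: growth, Lipschitz dependence, uniqueness and existence *)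

Section ProximalPoint.
Context {R : realType} {d : nat} (X : set 'rV[R]_d) (f : 'rV[R]_d -> R).
Variables rho rb : R.

(** The proximal point of f plus the indicator of X with parameter 1/rb, stated without extended
    values. Taking [f = 0] and [rb = 2] recovers the nearest-point projection, so both maps share
    one theory. *)
Definition is_prox (z p : 'rV[R]_d) : Prop :=
  X p /\ forall q, X q ->
    f p + rb / 2 * inner (p - z) (p - z) <= f q + rb / 2 * inner (q - z) (q - z).

Hypothesis rho_lt_rb : rho < rb.
Hypothesis X_convex : convex_set_of X.
Hypothesis f_wc : weakly_convex rho f.

(** The proximal objective is strongly convex with modulus [rb - rho]: minimality of [p] is tested
    on the segment towards [q], and [t] tends to 0. *)
Lemma prox_growth z p q : is_prox z p -> X q ->
  f p + rb / 2 * inner (p - z) (p - z) + (rb - rho) / 2 * inner (q - p) (q - p)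
  <= f q + rb / 2 * inner (q - z) (q - z).
Proof.
move=> [Xp pmin] Xq.
set N := inner (q - p) (q - p).
have N0 : 0 <= N by exact: inner_ge0.
apply: (@ler_vanishing _ _ _ ((rb - rho) / 2 * N)) => [|t /andP[t0 t1]].
  by rewrite mulr_ge0// divr_ge0// subr_ge0 ltW.
have t01 : 0 <= t <= 1 by rewrite (ltW t0).
have := pmin _ (X_convex Xq Xp t01).
have := weakly_convex_ineq f_wc q p t01.
rewrite -/N; set A := f (_ + _) => h1 h2.
have E : inner (t *: q + (1 - t) *: p - z) (t *: q + (1 - t) *: p - z) =
   t * inner (q - z) (q - z) + (1 - t) * inner (p - z) (p - z) - t * (1 - t) * N.
  by rewrite /N !innerE (innerC p q) (innerC z q) (innerC z p); ring.
rewrite E in h2.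
set a := inner (p - z) _ in h2 *; set b := inner (q - z) _ in h2 *.
rewrite -(ler_pM2l t0); nra.
Qed.

(** Adding the two growth inequalities gives (rb-rho)|p-p'|^2 <= rb <p-p', z-z'>. The square of
    (rb-rho)(p-p') - rb(z-z') then eliminates the cross term. *)
Lemma prox_lipschitz z z' p p' : is_prox z p -> is_prox z' p' ->
  (rb - rho) ^+ 2 * inner (p - p') (p - p') <= rb ^+ 2 * inner (z - z') (z - z').
Proof.
move=> pz pz'.
have := prox_growth pz (proj1 pz'); have := prox_growth pz' (proj1 pz).
have := inner_ge0 ((rb - rho) *: (p - p') - rb *: (z - z')).
rewrite !innerE (innerC p' p) (innerC z p) (innerC z' p) (innerC z p') (innerC z' p') (innerC z' z).
set pp := inner p p; set p'p' := inner p' p'; set pp' := inner p p'.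
set zz := inner z z; set z'z' := inner z' z'; set zz' := inner z z'.
set pz0 := inner p z; set pz1 := inner p z'; set pz2 := inner p' z; set pz3 := inner p' z'.
have c0 : 0 < rb - rho by rewrite subr_gt0.
move=> h1 h2 h3.
have h4 : (rb - rho) * (pp - 2 * pp' + p'p') <= rb * (pz0 - pz1 - pz2 + pz3) by lra.
have := ler_wpM2l (ltW c0) h4; nra.
Qed.

Lemma prox_unique z p p' : is_prox z p -> is_prox z p' -> p = p'.
Proof.
move=> pz pz'; have := prox_lipschitz pz pz'.
rewrite subrr inner0r mulr0 pmulr_rle0 ?exprn_gt0 ?subr_gt0// => /inner_eq0 h.
by apply/eqP; rewrite -subr_eq0 h.
Qed.

Hypothesis X_nonempty : X !=set0.
Hypothesis X_closed : closed X.
Hypothesis f_sub : forall x, X x -> exists v, forall y, X y ->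
  f x + inner v (y - x) - rho / 2 * inner (y - x) (y - x) <= f y.

Lemma prox_exists z : exists p, is_prox z p.
Proof.
pose c := rb - rho; have c0 : 0 < c by rewrite subr_gt0.
pose psi q := f q + rb / 2 * inner (q - z) (q - z).
have psi_lb : exists B : R, forall q, X q -> B <= psi q.
  have [a Xa] := X_nonempty; have [v va] := f_sub Xa.
  (* After expanding around [z], the quadratic minorant at [a] plus the proximal term has linear
     coefficient [w] and leading coefficient c/2; completing the square bounds it from below. *)
  pose w := v - rho *: (z - a).
  exists (f a + inner v (z - a) - rho / 2 * inner (z - a) (z - a)
          - inner w w / (2 * c)) => q Xq.
  have h1 := va _ Xq.
  have h2 : 0 <= inner (c *: (q - z) + w) (c *: (q - z) + w) / (2 * c).
    by rewrite divr_ge0 ?inner_ge0// mulr_ge0// ltW.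
  have h3 (u w' : 'rV[R]_d) : inner (c *: u + w') (c *: u + w') / (2 * c) =
      c / 2 * inner u u + inner w' u + inner w' w' / (2 * c).
    by rewrite !innerE (innerC u); field; rewrite gt_eqF.
  rewrite h3 in h2.
  have key (u b : 'rV[R]_d) (Fq K : R) :
      f a + inner v (u + b) - rho / 2 * inner (u + b) (u + b) <= Fq ->
      0 <= c / 2 * inner u u + inner (v - rho *: b) u + K ->
      f a + inner v b - rho / 2 * inner b b - K <= Fq + rb / 2 * inner u u.
    by rewrite !innerE (innerC b u) /c; lra.
  by apply: key h2; rewrite addrA subrK.
have [B psiB] := psi_lb.
pose S := psi @` X.
have S0 : S !=set0 by case: X_nonempty => a Xa; exists (psi a), a.
have infS : has_inf S by split=> //; exists B => _ [q Xq <-]; exact: psiB.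
pose m := inf S.
have mle q : X q -> m <= psi q by move=> Xq; apply: ge_inf; [case: infS|exists q].
(* Strong convexity at the midpoint: two nearly optimal points are close to each other, hence
   minimizing sequences are Cauchy. *)
have mid q q' : X q -> X q' -> c / 8 * inner (q - q') (q - q') <=
    (psi q + psi q') / 2 - m.
  move=> Xq Xq'.
  have t01 : 0 <= (2^-1 : R) <= 1 by lra.
  have := mle _ (X_convex Xq Xq' t01); have := weakly_convex_ineq f_wc q q' t01.
  rewrite /psi /c; set A := f (_ + _); rewrite !innerE (innerC q' q) (innerC z q) (innerC z q').
  by lra.
have /choice[q_ q_P] : forall n : nat, exists q, X q /\ psi q < m + n.+1%:R^-1.
  move=> n; have [|_ [q Xq <-] ltq] := @inf_adherent _ S n.+1%:R^-1 _ infS.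
    by rewrite invr_gt0.
  by exists q.
have Xq_ n : X (q_ n) by case: (q_P n).
have q_cauchy : cauchy (q_ @ \oo).
  apply: cauchy_exP => e e0.
  have [N NP] : exists N : nat, (N.+1%:R^-1 : R) < c / 8 * e ^+ 2.
    have /ltr_add_invr[N] : (0 : R) < c / 8 * e ^+ 2.
      by rewrite !mulr_gt0 ?exprn_gt0 ?invr_gt0.
    by rewrite add0r => ?; exists N.
  exists (q_ N); exists N => // n /= Nn.
  rewrite -ball_normE/= -(@ltr_pXn2r _ 2) ?nnegrE ?(ltW e0)//.
  apply: (le_lt_trans (norm_le_inner _)).
  have c8 : 0 < c / 8 by rewrite divr_gt0.
  rewrite -(ltr_pM2l c8); apply: le_lt_trans NP.
  have := mid _ _ (Xq_ N) (Xq_ n).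
  have := (q_P N).2; have := (q_P n).2.
  have : (n.+1%:R^-1 : R) <= N.+1%:R^-1.
    by rewrite lef_pV2 ?posrE// ler_nat ltnS.
  move: (n.+1%:R^-1) (N.+1%:R^-1) (psi (q_ n)) (psi (q_ N)) (c / 8 * _) => i j a b k.
  clearbody m; clear => *; lra.
pose p : 'rV[R]_d := lim (q_ @ \oo).
have qp : q_ @ \oo --> p by exact: cauchy_cvg q_cauchy.
have Xp : X p.
  by apply: (@closed_cvg _ _ (\oo : set_system nat) _ q_ X X_closed _ p qp); apply: nearW.
exists p; split=> // q Xq.
apply: le_trans (mle _ Xq).
have [v vp] := f_sub Xp.
apply/ler_addgt0Pr => e e0.
(* The subgradient at [p] gives psi(q_n) >= psi(p) + <w, q_n - p> + (rb-rho)/2 |q_n - p|^2, which is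
   lower semicontinuity along the sequence. The error [e] is shared equally between the linear term
   and the gap to the infimum. *)
pose w := v + rb *: (p - z); pose W := \sum_i `|w 0 i|.
have W0 : 0 <= W by apply: sumr_ge0.
have W1 : 0 < W + 1 by rewrite ltr_wpDl.
have e2 : 0 < e / 2 by rewrite divr_gt0.
have [N1 _ N1P] : \forall n \near \oo, `|p - q_ n| < e / 2 / (W + 1).
  by move/cvgrPdist_lt : qp; apply; rewrite divr_gt0.
have [N2 N2P] : exists N : nat, (N.+1%:R^-1 : R) < e / 2.
  by have /ltr_add_invr[N] := e2; rewrite add0r => ?; exists N.
pose n := maxn N1 N2.
have h1 := N1P n (leq_maxl _ _).
have h2 : (n.+1%:R^-1 : R) <= N2.+1%:R^-1.
  by rewrite lef_pV2 ?posrE// ler_nat ltnS leq_maxr.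
have h3 := (q_P n).2.
have h4 := vp _ (Xq_ n).
have h5 : - inner w (q_ n - p) <= e / 2.
  apply: (le_trans (ler_norm _)); rewrite normrN.
  apply: (le_trans (inner_norm_le _ _)).
  move: h1; rewrite distrC ltr_pdivlMr// -/W => h1.
  by have := normr_ge0 (q_ n - p); nra.
have h6 : 0 <= (rb - rho) / 2 * inner (q_ n - p) (q_ n - p).
  by rewrite mulr_ge0 ?inner_ge0// divr_ge0// ltW.
have h7 : inner (q_ n - z) (q_ n - z) = inner (p - z) (p - z)
   + 2 * inner (p - z) (q_ n - p) + inner (q_ n - p) (q_ n - p).
  by rewrite !innerE (innerC p (q_ n)) (innerC z (q_ n)) (innerC z p); ring.
have h8 : psi (q_ n) <= m + e / 2 by rewrite (le_trans (ltW h3))// lerD2l (le_trans h2)// ltW.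
move: h4 h5 h6 h8; rewrite /psi h7 /w (innerDl v) innerZl.
by clearbody m p n; clear; lra.
Qed.

End ProximalPoint.

(** * The Moreau envelope, its first-order expansion and its gradient *)

Section MoreauEnvelope.
Context {R : realType} {d : nat} (X : set 'rV[R]_d) (f : 'rV[R]_d -> R).
Variables rho rb : R.
Hypothesis rb_gt0 : 0 < rb.
Let F := moreau (phi_of f X) rb^-1.

Lemma moreau_proxE z p : is_prox X f rb z p ->
  F z = f p + rb / 2 * inner (p - z) (p - z).
Proof.
move=> [Xp pmin]; rewrite /F /moreau.
have E y : enorm (y - z) ^+ 2 / (2 * rb^-1) = rb / 2 * inner (y - z) (y - z).
  by rewrite enormK; field; rewrite gt_eqF.
rewrite (_ : ereal_inf _ = (f p + rb / 2 * inner (p - z) (p - z))%:E)//.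
apply/eqP; rewrite eq_le; apply/andP; split.
  apply: ereal_inf_lbound; exists p => //.
  by rewrite /phi_of asboolT// E.
apply: le_ereal_inf_tmp => _ [y _ <-]; rewrite /phi_of E.
case: ifPn => [/asboolP Xy|_]; last by rewrite addye// leey.
by rewrite -EFinD lee_fin pmin.
Qed.

Lemma min_le_moreau z p : is_prox X f rb z p ->
  (min_ext (phi_of f X) <= (F z)%:E)%E.
Proof.
move=> zp; rewrite (moreau_proxE zp).
apply: (@le_trans _ _ (f p)%:E).
  by apply: ereal_inf_lbound; exists p => //; rewrite /phi_of asboolT//; case: zp.
by rewrite lee_fin lerDl mulr_ge0 ?inner_ge0// divr_ge0// ltW.
Qed.

Lemma moreau_le z p q : is_prox X f rb z p -> X q ->
  F z <= f q + rb / 2 * inner (q - z) (q - z).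
Proof. by move=> zp Xq; rewrite (moreau_proxE zp); case: zp => _; apply. Qed.

Hypothesis rho_lt_rb : rho < rb.
Hypothesis X_convex : convex_set_of X.
Hypothesis f_wc : weakly_convex rho f.

(** Testing the envelope at each point with the proximal point of the other bounds the increment
    from both sides. The discrepancy <p'-p, z'-z> is quadratic by [prox_lipschitz]. This yields both
    the gradient and the measurability of the envelope. *)
Lemma moreau_expansion z z' p p' : is_prox X f rb z p -> is_prox X f rb z' p' ->
  `|F z' - F z - rb * inner (z - p) (z' - z)|
    <= rb * ((rb / (rb - rho)) ^+ 2 + 1) / 2 * inner (z' - z) (z' - z).
Proof.
move=> zp zp'.
have h1 := moreau_le zp' (proj1 zp); have h2 := moreau_le zp (proj1 zp').
have := prox_lipschitz rho_lt_rb X_convex f_wc zp' zp.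
have c0 : 0 < rb - rho by rewrite subr_gt0.
rewrite -ler_pdivlMl ?exprn_gt0// mulrA -exprVn -exprMn (mulrC _ rb) => h3.
have h4 := inner_bound (p' - p) (z' - z).
have := inner_ge0 (z' - z) => h5.
have h6 := sqr_ge0 (rb / (rb - rho)).
move: h3 h4 h6; set K := (_ / _) ^+ 2.
move: h1 h2; rewrite (moreau_proxE zp) (moreau_proxE zp').
set D := inner (z' - z) (z' - z) in h5 *; set E := inner (p' - p) (p' - p).
have e1 : inner (p - z') (p - z') =
   inner (p - z) (p - z) + 2 * inner (z - p) (z' - z) + D.
  by rewrite /D !innerE (innerC z p) (innerC z' p) (innerC z' z); ring.
have e2 : inner (p' - z) (p' - z) = inner (p' - z') (p' - z')
   - 2 * inner (z - p) (z' - z) - D + 2 * inner (p' - p) (z' - z).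
  by rewrite /D !innerE (innerC z p') (innerC z' p') (innerC z' z); ring.
rewrite e1 e2; set I := inner (z - p) _; set J := inner (p' - p) _.
set A := inner (p - z) _; set B := inner (p' - z') _.
move=> h1 h2 h3 /ler_normlP[h4 h4'] h6.
have rb0 := ltW rb_gt0.
have h7 : 0 <= rb * K * D by apply: mulr_ge0 => //; apply: mulr_ge0.
have h8 : 0 <= rb * D by apply: mulr_ge0.
have h9 : 0 <= rb * (K * D - E) by rewrite mulr_ge0 ?subr_ge0// ltW.
have h10 : 0 <= rb * ((E + D) / 2 - J) by rewrite mulr_ge0 ?subr_ge0// ltW.
have h11 : 0 <= rb * ((E + D) / 2 + J).
  by rewrite mulr_ge0 ?(ltW rb_gt0)// -lerBlDr sub0r.
rewrite ler_norml; apply/andP; split; lra.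
Qed.

Hypothesis X_nonempty : X !=set0.
Hypothesis X_closed : closed X.
Hypothesis f_sub : forall x, X x -> exists v, forall y, X y ->
  f x + inner v (y - x) - rho / 2 * inner (y - x) (y - x) <= f y.

Lemma moreau_grad z p : is_prox X f rb z p -> grad F z = rb *: (z - p).
Proof.
move=> zp; apply/rowP => i; rewrite !mxE.
pose e : 'rV[R]_d := delta_mx 0 i.
pose K := rb * ((rb / (rb - rho)) ^+ 2 + 1) / 2.
have K0 : 0 <= K.
  by rewrite /K divr_ge0// mulr_ge0 ?(ltW rb_gt0)// addr_ge0// sqr_ge0.
apply: cvg_lim => //.
apply/cvgrPdist_le => eps eps0.
have eK : 0 < eps / (K + 1) by rewrite divr_gt0// ltr_wpDl.
near=> h.
have h0 : h != 0 by near: h; exact: nbhs_dnbhs_neq.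
have hK : `|h| < eps / (K + 1).
  near: h; apply: dnbhs0_lt; exact: eK.
(* The expansion between [z] and [h *: e + z] has remainder at most K h^2, so the difference
   quotient is within K|h| of its limit. *)
have [p' zp'] := prox_exists rho_lt_rb X_convex f_wc X_nonempty X_closed f_sub (h *: e + z).
have := moreau_expansion zp zp'.
rewrite addrK innerZr inner_delta innerZl innerZr inner_delta !mxE !eqxx mulr1 -/K => hh.
rewrite distrC /= -[rb * _](mulKf h0) /GRing.scale/= -mulrBr normrM normfV.
rewrite ler_pdivrMl ?normr_gt0// (mulrCA h rb).
apply: (le_trans hh); rewrite -expr2 -real_normK ?num_real// mulrC expr2 -mulrA.
rewrite ler_wpM2l// (le_trans (ler_wpM2r K0 (ltW hK)))//.
rewrite mulrAC ler_pdivrMr ?ltr_wpDl// ler_wpM2l ?(ltW eps0)// lerDl//.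
Unshelve. all: by end_near. Qed.

End MoreauEnvelope.

(** The law of [(Y, Z)] agrees with the product of the law of [Y] and [mu] on rectangles, hence
    everywhere; Tonelli then separates the two integrations. *)
Lemma indep_integral2 {R : realType} {d0 d1 d2}
    {T0 : measurableType d0} {T1 : measurableType d1} {T2 : measurableType d2}
    (P0 : probability T0 R) (mu : probability T2 R)
    (Y : T0 -> T1) (Z : T0 -> T2) (h : T1 * T2 -> \bar R) :
  measurable_fun setT Y -> measurable_fun setT Z ->
  (forall A B, measurable A -> measurable B ->
    P0 (Y @^-1` A `&` Z @^-1` B) = (P0 (Y @^-1` A) * mu B)%E) ->
  measurable_fun [set: T1 * T2] h -> (forall p, 0 <= h p)%E ->
  (\int[P0]_w h (Y w, Z w) = \int[P0]_w \int[mu]_z h (Y w, z))%E.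
Proof.
move=> mY mZ YZ mh h0.
pose Y' : {mfun T0 >-> T1} := HB.pack Y (isMeasurableFun.Build _ _ _ _ _ mY).
have mYZ : measurable_fun setT (fun w => (Y w, Z w)) by exact/measurable_fun_pair.
pose YZ' : {mfun T0 >-> (T1 * T2)%type} :=
  HB.pack (fun w => (Y w, Z w)) (isMeasurableFun.Build _ _ _ _ _ mYZ).
transitivity (\int[distribution P0 YZ']_p h p)%E.
  by rewrite ge0_integral_pushforward.
transitivity (\int[(distribution P0 Y') \x mu]_p h p)%E.
  apply: eq_measure_integral => A mA _; apply/esym.
  apply: (@product_measure_unique _ _ _ _ _ (distribution P0 Y') mu (distribution P0 YZ') _ A mA).
  by move=> B C mB mC; rewrite -YZ.
rewrite fubini_tonelli1// ge0_integral_pushforward//.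
- exact: measurable_fun_fubini_tonelli_F.
- by move=> y _; apply: integral_ge0.
Qed.

(** * Borel measurability of vector-valued maps *)

Section BorelVec.
Context {R : realType} {d : nat}.

(** An alias of the row vectors whose measurable sets are exactly those of [borel_vec], so that the
    joint measurability of the oracle can be read in a product of measurable types. *)
Definition bvec := g_sigma_algebraType [set A : set 'rV[R]_d | open A].
HB.instance Definition _ := Measurable.on bvec.

Lemma continuous_bvec_measurable (g : 'rV[R]_d -> R) :
  continuous g -> measurable_fun setT (g : bvec -> R).
Proof.
move=> cg; apply: (measurability _ (RGenOpens.measurableE R)).
move=> _ [_ [a [b ->]] <-]; rewrite setTI; apply: sub_sigma_algebra => /=.
by apply: open_comp; [move=> y _; exact: cg|exact: interval_open].
Qed.

Lemma coord_bvec_measurable (i : 'I_d) :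
  measurable_fun setT (fun y : bvec => (y : 'rV[R]_d) 0 i).
Proof. by apply: continuous_bvec_measurable; exact: coord_continuous. Qed.

(** An open set is a countable union of boxes with rational centres, and the preimage of a box is a
    finite intersection of conditions on the coordinates. *)
Lemma bvec_measurable d1 (T : measurableType d1) (h : T -> bvec) :
  (forall i, measurable_fun setT (fun w => (h w : 'rV[R]_d) 0 i)) ->
  measurable_fun setT h.
Proof.
move=> mh; apply: (@measurability _ _ T bvec _ _ [set A | open A]) => //.
move=> _ [V oV <-]; rewrite setTI.
pose box (k : 'rV[rat]_d * nat) : set 'rV[R]_d :=
  [set y | forall i, `|y 0 i - ratr (k.1 0 i)| < k.2.+1%:R^-1].
(* Boxes that leave [V] contribute the empty set, so the union runs over the whole countable index
   type. *)
pose F k : set T := if `[< box k `<=` V >] then h @^-1` box k else set0.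
have -> : h @^-1` V = \bigcup_k F k.
  apply/seteqP; split=> [w /= Vhw|w [k _]]; last first.
    by rewrite /F; case: ifPn => // /asboolP kV /kV.
  have /nbhs_ballP[e /= e0 eV] : nbhs (h w : 'rV[R]_d) V by exact: open_nbhs_nbhs.
  (* One half of [e] is for the distance from [h w] to the rational centre, the other for the
     distance from the centre to a point of the box. *)
  have [n nP] : exists n : nat, (n.+1%:R^-1 : R) < e / 2.
    have /ltr_add_invr[n] : 0 < e / 2 by rewrite divr_gt0.
    by rewrite add0r => ?; exists n.
  have /choice[q qP] : forall i : 'I_d, exists r : rat,
      `|(h w : 'rV[R]_d) 0 i - ratr r| < n.+1%:R^-1.
    move=> i; have i0 : (0 : R) < n.+1%:R^-1 by rewrite invr_gt0.
    have /rat_in_itvoo[r] : (h w : 'rV[R]_d) 0 i - n.+1%:R^-1 <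
        (h w : 'rV[R]_d) 0 i + n.+1%:R^-1.
      by rewrite ltrD2l (lt_trans _ i0)// oppr_lt0.
    rewrite in_itv/= => /andP[r1 r2]; exists r.
    by rewrite ltr_distlC r1.
  exists (\row_i q i, n) => //; rewrite /F asboolT.
    by move=> i /=; rewrite mxE.
  move=> y yb; apply: eV; split=> // i j; rewrite ord1.
  have := yb j; have := qP j; rewrite /= mxE /ball/= => h1 h2.
  apply: (le_lt_trans (ler_distD (ratr (q j)) _ _)).
  by rewrite (splitr e) (distrC (ratr _)) ltrD// (lt_trans _ nP).
apply: countable_bigcupT_measurable => // k; rewrite /F; case: ifPn => // _.
rewrite (_ : _ @^-1` _ = \bigcap_(i in [set: 'I_d])
    ((fun w => (h w : 'rV[R]_d) 0 i - ratr (k.1 0 i)) @^-1` (ball (0:R) k.2.+1%:R^-1))).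
  apply: fin_bigcap_measurable => // i _; rewrite -[X in measurable X]setTI.
  apply: (measurable_funB (mh i) (measurable_cst _)) => //.
  by apply: open_measurable; exact: ball_open.
apply/seteqP; split=> w /=.
  by move=> H i _; rewrite /ball/= sub0r normrN; exact: H.
by move=> H i; have := H i Logic.I; rewrite /ball/= sub0r normrN.
Qed.

Lemma inner_measurable d1 (T : measurableType d1) (g h : T -> bvec) :
  measurable_fun setT g -> measurable_fun setT h ->
  measurable_fun setT (fun w => inner (g w : 'rV[R]_d) (h w : 'rV[R]_d)).
Proof.
move=> mg mh; rewrite /inner; apply: measurable_sum => i.
by apply: measurable_funM; apply: (measurableT_comp (coord_bvec_measurable i)).
Qed.

Lemma lipschitz_bvec_measurable (g : 'rV[R]_d -> 'rV[R]_d) (K : R) :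
  (forall y z, inner (g y - g z) (g y - g z) <= K * inner (y - z) (y - z)) ->
  measurable_fun setT (g : bvec -> bvec).
Proof.
move=> gK; apply: bvec_measurable => i.
suff cg : continuous (fun y : 'rV[R]_d => g y 0 i) by exact: continuous_bvec_measurable.
move=> y.
(* The factor [d%:R] passes from the Euclidean square to the sup norm. Since C >= 1, the bound
   C|y-z| < e implies C|y-z|^2 < e^2. *)
pose C := `|K| * d%:R + 1; have C0 : 0 < C by rewrite ltr_wpDl.
apply/(@cvgrPdist_lt _ R^o _ (nbhs y)) => e e0.
have eC : 0 < e / C by rewrite divr_gt0.
near=> z.
have yz : `|y - z| < e / C by near: z; exact: cvgr_dist_lt.
rewrite -(@ltr_pXn2r _ 2) ?nnegrE ?(ltW e0)// real_normK ?num_real//.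
have -> : g y 0 i - g z 0 i = (g y - g z) 0 i by rewrite !mxE.
apply: (le_lt_trans (inner_coord_sqr _ _)); apply: (le_lt_trans (gK _ _)).
apply: (@le_lt_trans _ _ (C * `|y - z| ^+ 2)).
  apply: (@le_trans _ _ (`|K| * inner (y - z) (y - z))).
    by rewrite ler_wpM2r ?inner_ge0// ler_norm.
  apply: (@le_trans _ _ (`|K| * (d%:R * `|y - z| ^+ 2))).
    by rewrite ler_wpM2l// inner_le_norm.
  by rewrite mulrA ler_wpM2r ?exprn_ge0// /C lerDl.
have C1 : 1 <= C by rewrite /C lerDr mulr_ge0.
move: yz; rewrite ltr_pdivlMr// => yz.
rewrite -(ltr_pM2l C0); apply: (@lt_le_trans _ _ (e ^+ 2)).
  rewrite mulrA -expr2 -exprMn mulrC ltr_pXn2r ?nnegrE ?(ltW e0)//.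
  by rewrite mulr_ge0// ltW.
by rewrite ler_peMl ?exprn_ge0// ltW.
Unshelve. all: by end_near. Qed.

(** A first-order expansion with quadratic remainder forces continuity, whatever the regularity of
    [g]. *)
Lemma quadratic_bvec_measurable (F : 'rV[R]_d -> R) (g : 'rV[R]_d -> 'rV[R]_d) (K : R) :
  (forall y z, `|F z - F y - inner (g y) (z - y)| <= K * inner (z - y) (z - y)) ->
  measurable_fun setT (F : bvec -> R).
Proof.
move=> FK; suff cF : continuous F by exact: continuous_bvec_measurable.
move=> y.
pose W := \sum_i `|g y 0 i|.
have W0 : 0 <= W by apply: sumr_ge0.
pose C := W + `|K| * d%:R + 1.
have C0 : 0 < C by rewrite ltr_wpDl// addr_ge0// mulr_ge0.
apply/(@cvgrPdist_lt _ R^o _ (nbhs y)) => e e0.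
have eC : 0 < e / C by rewrite divr_gt0.
near=> z.
have yz : `|y - z| < e / C by near: z; exact: cvgr_dist_lt.
(* Within distance 1 the quadratic remainder is dominated by the norm itself, so one constant [C]
   covers both terms. *)
have yz1 : `|y - z| < 1 by near: z; exact: cvgr_dist_lt.
rewrite distrC in yz yz1; rewrite distrC.
have -> : F z - F y = (F z - F y - inner (g y) (z - y)) + inner (g y) (z - y).
  by rewrite subrK.
apply: (le_lt_trans (ler_normD _ _)).
have h1 := inner_norm_le (g y) (z - y); rewrite -/W in h1.
have h2 : K * inner (z - y) (z - y) <= `|K| * d%:R * `|z - y|.
  apply: (@le_trans _ _ (`|K| * inner (z - y) (z - y))).
    by rewrite ler_wpM2r ?inner_ge0// ler_norm.
  rewrite -mulrA ler_wpM2l// (le_trans (inner_le_norm _))// ler_wpM2l//.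
  by rewrite expr2 ler_piMl// ltW.
have h3 := FK y z.
move: yz; rewrite ltr_pdivlMr// /C => yz.
have := normr_ge0 (z - y); lra.
Unshelve. all: by end_near. Qed.

End BorelVec.
Arguments bvec : clear implicits.

(** Both sides are finite measures in [E], namely the restriction of [P0] to [D] and [P0] scaled by
    the mass of [D]. They agree on a pi-system, hence on the sigma-algebra it generates. *)
Lemma pi_system_indep {R : realType} {d0} {T0 : measurableType d0}
    (P0 : probability T0 R) (G : set (set T0)) (D : set T0) :
  G `<=` measurable -> setI_closed G -> G setT -> measurable D ->
  (forall E, G E -> P0 (E `&` D) = P0 E * P0 D)%E ->
  forall E, <<s G >> E -> (P0 (E `&` D) = P0 E * P0 D)%E.
Proof.
move=> Gm GI GT mD GD E sGE.
have fD : P0 D \is a fin_num by exact: fin_num_measure.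
have D0 : (0 <= fine (P0 D))%R by exact: fine_ge0.
have : mrestr P0 mD E = mscale (NngNum D0) P0 E.
  apply: (@g_sigma_algebra_measure_unique _ R T0 G Gm (fun=> setT)) => //.
  - by rewrite bigcup_const.
  - move=> A GA; rewrite -[LHS]/(P0 (A `&` D)) GD//.
    by rewrite -[RHS]/((fine (P0 D))%:E * P0 A)%E fineK// muleC.
  - by move=> _; rewrite -[ltLHS]/(P0 (setT `&` D)) setTI -ge0_fin_numE.
rewrite -[LHS]/(P0 (E `&` D)) => ->.
by rewrite -[LHS]/((fine (P0 D))%:E * P0 E)%E fineK// muleC.
Qed.

(** * The filtration of the samples and its independence properties *)

Section Filtration.
Context {R : realType} {dO d0 : measure_display} {Omega : measurableType dO}
  {Omega0 : measurableType d0} (P0 : probability Omega0 R).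
Variables (xi : nat -> Omega0 -> Omega) (tstar : Omega0 -> nat) (T : nat).
Hypothesis xi_measurable : forall t, measurable_fun setT (xi t).
Hypothesis tstar_measurable : forall t, measurable (tstar @^-1` [set t]).
Hypothesis xi_indep : forall A : nat -> set Omega,
  (forall t, measurable (A t)) -> forall S : set nat,
  P0 (tstar @^-1` S `&` \bigcap_(t in `I_T.+1) (xi t @^-1` A t)) =
  (P0 (tstar @^-1` S) * \prod_(t < T.+1) P0 (xi t @^-1` A t))%E.

(* A pi-system generating the sigma-algebra of the samples xi_s, s < t. *)
Definition cylinder (t : nat) : set (set Omega0) :=
  [set E | exists A : nat -> set Omega,
    [/\ forall s, measurable (A s), forall s, (t <= s)%N -> A s = setT &
        E = \bigcap_(s in `I_T.+1) (xi s @^-1` A s)]].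

(** [Omega0] with the smaller sigma-algebra of the earlier samples: being adapted becomes plain
    measurability on this type. *)
Definition past (t : nat) := g_sigma_algebraType (cylinder t).
HB.instance Definition _ t := Measurable.on (past t).

Lemma xi_preimage_measurable t (A : set Omega) :
  measurable A -> measurable (xi t @^-1` A).
Proof. by move=> mA; rewrite -[X in measurable X]setTI; exact: xi_measurable. Qed.

Lemma tstar_preimage_measurable (S : set nat) : measurable (tstar @^-1` S).
Proof.
have -> : tstar @^-1` S = \bigcup_(n in S) (tstar @^-1` [set n]).
  apply/seteqP; split=> [w Sw|w [n Sn /= wn]]; first by exists (tstar w).
  by rewrite /preimage /= wn.
exact: bigcup_measurable.
Qed.

Lemma cylinder_measurable t : cylinder t `<=` measurable.
Proof.
move=> _ [A [mA _ ->]]; apply: bigcap_measurableType => s _.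
exact: xi_preimage_measurable.
Qed.

Lemma cylinder_setI t : setI_closed (cylinder t).
Proof.
move=> _ _ [A [mA At ->]] [B [mB Bt ->]].
exists (fun s => A s `&` B s); split=> [s|s ts|].
- exact: measurableI.
- by rewrite At// Bt// setIT.
- by rewrite -bigcapI.
Qed.

Lemma cylinder_setT t : cylinder t setT.
Proof.
by exists (fun=> setT); split=> //; apply/seteqP; split=> // w _ s.
Qed.

Lemma cylinder_le s t : (s <= t)%N -> cylinder s `<=` cylinder t.
Proof.
move=> st _ [A [mA As ->]]; exists A; split=> // k tk.
by apply: As; exact: leq_trans tk.
Qed.

Lemma past_measurable d1 (T1 : measurableType d1) t (Y : Omega0 -> T1) :
  measurable_fun setT (Y : past t -> T1) -> measurable_fun setT Y.
Proof.
move=> mY _ A mA; have := mY measurableT A mA; rewrite !setTI.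
exact: (smallest_sub (@sigma_algebra_measurable _ Omega0) (@cylinder_measurable t)).
Qed.

Lemma past_le d1 (T1 : measurableType d1) s t (Y : Omega0 -> T1) : (s <= t)%N ->
  measurable_fun setT (Y : past s -> T1) -> measurable_fun setT (Y : past t -> T1).
Proof.
move=> st mY _ A mA; have := mY measurableT A mA; rewrite !setTI.
by apply: sub_sigma_algebra2; exact: cylinder_le.
Qed.

Lemma past_xi s t : (s < t)%N -> (s <= T)%N ->
  measurable_fun setT (xi s : past t -> Omega).
Proof.
move=> st sT _ B mB; rewrite setTI; apply: sub_sigma_algebra.
exists (fun k => if k == s then B else setT); split=> [k|k tk|].
- by case: ifP.
- by case: eqP => // ks; rewrite ks leqNgt st in tk.
- apply/seteqP; split=> [w Bw k _ /=|w /(_ s sT) /=].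
  + by case: eqP => // ->.
  + by rewrite eqxx.
Qed.

Lemma past_indep_tstar t E (S : set nat) : <<s cylinder t >> E ->
  (P0 (E `&` tstar @^-1` S) = P0 E * P0 (tstar @^-1` S))%E.
Proof.
apply: pi_system_indep; [exact: cylinder_measurable|exact: cylinder_setI|
  exact: cylinder_setT|exact: tstar_preimage_measurable|].
move=> _ [A [mA _ ->]]; rewrite setIC xi_indep//.
(* With [S = setT] the joint formula becomes the product formula for the samples alone. *)
have := xi_indep mA setT; rewrite preimage_setT setTI probability_setT mul1e => ->.
by rewrite muleC.
Qed.

Lemma past_indep_xi t E (B : set Omega) : (t <= T)%N -> measurable B ->
  <<s cylinder t >> E ->
  (P0 (E `&` xi t @^-1` B) = P0 E * P0 (xi t @^-1` B))%E.
Proof.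
move=> tT mB; apply: pi_system_indep; [exact: cylinder_measurable|
  exact: cylinder_setI|exact: cylinder_setT|exact: xi_preimage_measurable|].
move=> _ [A [mA At ->]].
(* A cylinder of the past leaves coordinate [t] free, so inserting [B] there changes only the factor
   at [t], which was 1. *)
pose A' s := if s == t then B else A s.
have mA' s : measurable (A' s) by rewrite /A'; case: ifP.
have -> : \bigcap_(s in `I_T.+1) (xi s @^-1` A s) `&` xi t @^-1` B =
    \bigcap_(s in `I_T.+1) (xi s @^-1` A' s).
  apply/seteqP; split=> [w [Aw Bw] s sT /=|w A'w].
    by rewrite /A'; case: eqP => [->//|_]; exact: Aw.
  split=> [s sT /=|]; last by have := A'w t tT; rewrite /A' /= eqxx.
  have := A'w s sT; rewrite /A' /=; case: eqP => // -> _.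
  by rewrite At.
have tT1 : (t < T.+1)%N by [].
have := xi_indep mA setT; have := xi_indep mA' setT.
rewrite preimage_setT !setTI probability_setT !mul1e => -> ->.
rewrite (bigD1 (Ordinal tT1))//= [in RHS](bigD1 (Ordinal tT1))//= {1}/A' eqxx At//.
rewrite preimage_setT probability_setT mul1e muleC; congr (_ * _)%E.
apply: eq_bigr => i it; rewrite /A'; case: eqP => // ti.
by move/eqP: it; case; apply/val_inj.
Qed.

End Filtration.

(** The conditional bound is asked only at the values [Y w]: the oracle is controlled on X, where
    the iterates lie. *)
Lemma indep_integral2_le {R : realType} {d0 d1 d2}
    {T0 : measurableType d0} {T1 : measurableType d1} {T2 : measurableType d2}
    (P0 : probability T0 R) (mu : probability T2 R)
    (Y : T0 -> T1) (Z : T0 -> T2) (h : T1 * T2 -> \bar R) (K : T1 -> \bar R) :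
  measurable_fun setT Y -> measurable_fun setT Z ->
  (forall A B, measurable A -> measurable B ->
    P0 (Y @^-1` A `&` Z @^-1` B) = (P0 (Y @^-1` A) * mu B)%E) ->
  measurable_fun [set: T1 * T2] h -> (forall p, 0 <= h p)%E ->
  measurable_fun setT K -> (forall w, \int[mu]_z h (Y w, z) <= K (Y w))%E ->
  (\int[P0]_w h (Y w, Z w) <= \int[P0]_w K (Y w))%E.
Proof.
move=> mY mZ YZ mh h0 mK hK; rewrite (indep_integral2 mY mZ YZ mh h0).
apply: ge0_le_integral => //.
- by move=> w _; apply: integral_ge0.
- exact: (measurableT_comp (measurable_fun_fubini_tonelli_F h mh h0) mY).
- exact: (measurableT_comp mK).
Qed.

Section OffNull.
Import HBNNSimple.

(* The integrand on the left need not be measurable. *)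
Lemma integral_le_off_null {R : realType} {d0} {T0 : measurableType d0}
    (mu : {measure set T0 -> \bar R}) (N : set T0) (f g : T0 -> \bar R) :
  measurable N -> mu N = 0%E -> (forall w, 0 <= f w)%E ->
  measurable_fun setT g -> (forall w, 0 <= g w)%E ->
  (forall w, ~ N w -> f w <= g w)%E -> (\int[mu]_w f w <= \int[mu]_w g w)%E.
Proof.
move=> mN N0 f0 mg g0 fg; rewrite ge0_integralTE//.
apply: ge_ereal_sup => _ [h hf <-].
rewrite -integralT_nnsfun; apply: ae_ge0_le_integral => //.
- by move=> w _; rewrite lee_fin.
- by apply/measurable_EFinP; exact: measurable_funPT.
- exists N; split=> // w /= nh; apply: contrapT => Nw; apply: nh => _.
  exact: le_trans (hf w) (fg w Nw).
Qed.

End OffNull.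

(** * Moments and measurability of the stochastic oracle *)

Section Oracle.
Context {R : realType} {d : nat} {dO : measure_display} {Omega : measurableType dO}.

Lemma oracle_second_moment (P : probability Omega R) (g : Omega -> 'rV[R]_d)
    (v c : 'rV[R]_d) (a L : R) :
  (forall i, P.-integrable setT (fun w => (g w 0 i)%:E) /\
     (\int[P]_w (g w 0 i)%:E = (v 0 i)%:E)%E) ->
  (\int[P]_w (enorm (g w) ^+ 2)%:E <= (L ^+ 2)%:E)%E ->
  (\int[P]_w (inner (c - a *: g w) (c - a *: g w))%:E <=
    (inner c c - 2 * a * inner v c + a ^+ 2 * L ^+ 2)%:E)%E.
Proof.
move=> gv gL.
have mg : measurable_fun setT (g : Omega -> bvec R d).
  apply: bvec_measurable => i; apply/measurable_EFinP.
  by case: (gv i) => /integrableP[].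
have E1 w : (inner (g w) c)%:E = (\sum_i (g w 0 i)%:E * (c 0 i)%:E)%E.
  by rewrite /inner -sumEFin.
have i1 : P.-integrable setT (fun w => (inner (g w) c)%:E).
  under eq_fun do rewrite E1.
  by apply: integrable_sum => // i _; apply: integrableZr => //; case: (gv i).
have e1 : (\int[P]_w (inner (g w) c)%:E = (inner v c)%:E)%E.
  under eq_integral do rewrite E1.
  rewrite integral_sum//; last first.
    by move=> i; apply: integrableZr => //; case: (gv i).
  rewrite /inner -sumEFin; apply: eq_bigr => i _.
  by rewrite integralZr//; case: (gv i) => // _ ->.
(* The second-moment bound provides the integrability that allows the integral of the expanded
   square to be split. *)
have i2 : P.-integrable setT (fun w => (inner (g w) (g w))%:E).
  apply/integrableP; split; first exact/measurable_EFinP/inner_measurable.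
  apply: (@le_lt_trans _ _ (L ^+ 2)%:E); last by rewrite ltry.
  apply: le_trans gL; apply: ge0_le_integral => //.
  - apply: measurableT_comp => //; exact/measurable_EFinP/inner_measurable.
  - under eq_fun do rewrite enormK; exact/measurable_EFinP/inner_measurable.
  - by move=> w _; rewrite enormK gee0_abs// lee_fin inner_ge0.
have gL' : (\int[P]_w (inner (g w) (g w))%:E <= (L ^+ 2)%:E)%E.
  by under eq_integral do rewrite -enormK.
have E2 w : (inner (c - a *: g w) (c - a *: g w))%:E =
  ((inner c c)%:E + ((- 2 * a)%:E * (inner (g w) c)%:E
     + (a ^+ 2)%:E * (inner (g w) (g w))%:E))%E.
  rewrite -!EFinM -!EFinD; congr EFin.
  by rewrite !innerE (innerC c (g w)); ring.
under eq_integral do rewrite E2.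
rewrite integralD//; last 2 first.
- exact: finite_measure_integrable_cst.
- by apply: integrableD => //; exact: integrableZl.
rewrite integralD//; [|exact: integrableZl|exact: integrableZl].
rewrite !integralZl// e1 integral_cst// [X in (_ * X)%E]probability_setT mule1.
rewrite (_ : inner c c - 2 * a * inner v c + a ^+ 2 * L ^+ 2 =
  inner c c + (- 2 * a * inner v c + a ^+ 2 * L ^+ 2)); last by ring.
rewrite !EFinD leeD2l// !EFinM leeD2l// lee_wpmul2l// lee_fin sqr_ge0//.
Qed.

Variables (X U : set 'rV[R]_d) (G : 'rV[R]_d -> Omega -> 'rV[R]_d).

(* G is only measurable over U, so it is cut off outside of X. *)
Definition oracle (p : bvec R d * Omega) : bvec R d :=
  if `[< X p.1 >] then G p.1 p.2 else 0.

Lemma oracle_measurable : closed X -> X `<=` U -> jointly_measurable U G ->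
  measurable_fun [set: bvec R d * Omega] oracle.
Proof.
move=> cX XU mG _ B mB; rewrite setTI.
have mX : measurable (X : set (bvec R d)).
  rewrite -[X]setCK; apply: measurableC; apply: sub_sigma_algebra => /=.
  exact: closed_openC.
pose GB : set (bvec R d * Omega) := (U `*` setT) `&` [set p | B (G p.1 p.2)].
have mGB : measurable GB.
  by rewrite measurable_prod_measurableType; exact: mG.
(* Over X the cut-off oracle is [G], covered by joint measurability since X lies in U; off X it is
   the constant 0. *)
have -> : oracle @^-1` B =
    (((X : set (bvec R d)) `*` setT) `&` GB)
    `|` (((~` X : set (bvec R d)) `*` setT) `&` (if `[< B 0 >] then setT else set0)).
  apply/seteqP; split=> [[y w]|[y w]]; rewrite /preimage /oracle /=.
    case: ifPn => [/asboolP Xy BG|/asboolP nXy B0].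
      by left; split=> //; split=> //; split=> //; exact: XU.
    by right; split=> //; rewrite asboolT.
  case=> [[[Xy _] [_ BG]]|[[nXy _]]]; first by rewrite asboolT.
  by rewrite (asboolF nXy); case: ifPn => // /asboolP.
apply: measurableU.
  by apply: measurableI => //; exact: measurableX.
apply: measurableI; first by apply: measurableX => //; exact: measurableC.
by case: ifP.
Qed.

End Oracle.

(** * The projection as the proximal map of the zero function *)

Section Projection.
Context {R : realType} {d : nat} (X : set 'rV[R]_d).

Lemma is_proj_prox z p : is_proj X z p -> is_prox X (fun=> 0) 2 z p.
Proof.
move=> [Xp pmin]; split=> // q Xq; rewrite !add0r divff ?mul1r ?pnatr_eq0//.
by rewrite -!enormK lerXn2r ?nnegrE ?sqrtr_ge0// pmin.
Qed.

Lemma proj_id p : X p -> is_prox X (fun=> 0) 2 p p.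
Proof.
move=> Xp; split=> // q Xq; rewrite !add0r divff ?mul1r ?pnatr_eq0//.
by rewrite subrr inner0r inner_ge0.
Qed.

Lemma weakly_convex0 : @weakly_convex R d 0 (fun=> 0).
Proof. by move=> x y t _; rewrite !mul0r !addr0 !mulr0 addr0. Qed.

Lemma proj_exists : X !=set0 -> closed X -> convex_set_of X ->
  forall z, exists p, is_prox X (fun=> 0) 2 z p.
Proof.
move=> X0 cX Xc; apply: (@prox_exists _ _ X _ 0) => //.
  exact: weakly_convex0.
by move=> x Xx; exists 0 => y Xy; rewrite innerC inner0r !mul0r subr0 addr0.
Qed.

(** With [rho = 0] and [rb = 2] the constant rb/(rb-rho) of [prox_lipschitz] is 1. *)
Lemma proj_nonexpansive z z' p p' : convex_set_of X ->
  is_prox X (fun=> 0) 2 z p -> is_prox X (fun=> 0) 2 z' p' ->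
  inner (p - p') (p - p') <= inner (z - z') (z - z').
Proof.
move=> Xc zp zp'.
have := @prox_lipschitz _ _ X _ 0 2 ltac:(by []) Xc weakly_convex0 _ _ _ _ zp zp'.
by rewrite subr0 ler_pM2l// exprn_gt0.
Qed.

End Projection.

Lemma descent_combine {R : realType} (r b k N H I0 I1 : R) :
  H <= (r / 2 - b) * N + k -> I1 <= I0 + - (r / 2) * N + H -> I1 <= I0 - b * N + k.
Proof. lra. Qed.

Lemma telescope_combine {R : realType} (c a r q L2 A B C S1 S2 F0 : R) :
  A <= B - a * c * r * C + a ^+ 2 * q * L2 / 2 ->
  c * r * S1 <= F0 - B + q * L2 / 2 * S2 ->
  c * r * (S1 + a * C) <= F0 - A + q * L2 / 2 * (S2 + a ^+ 2).
Proof. lra. Qed.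

(** * The iterates: adaptedness, independence and square integrability *)

Section StochasticSubgradient.
Context {R : realType} {d : nat} (rho : R) (X : set 'rV[R]_d) (f : 'rV[R]_d -> R).
Context {dO : measure_display} {Omega : measurableType dO} (P : probability Omega R).
Variables (U : set 'rV[R]_d) (G : 'rV[R]_d -> Omega -> 'rV[R]_d) (L : R).
Context {d0 : measure_display} {Omega0 : measurableType d0} (P0 : probability Omega0 R).
Variables (xi : nat -> Omega0 -> Omega) (tstar : Omega0 -> nat) (T : nat).
Variables (x0 : 'rV[R]_d) (alpha : nat -> R) (x : nat -> Omega0 -> 'rV[R]_d).

Hypothesis rho_gt0 : 0 < rho.
Hypothesis X_nonempty : X !=set0.
Hypothesis X_closed : closed X.
Hypothesis X_convex : convex_set_of X.
Hypothesis f_wc : weakly_convex rho f.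
Hypothesis xi_measurable : forall t, measurable_fun setT (xi t).
Hypothesis xi_law : forall t, (t <= T)%N -> forall A, measurable A ->
  P0 (xi t @^-1` A) = P A.
Hypothesis xi_indep : forall A : nat -> set Omega,
  (forall t, measurable (A t)) -> forall S : set nat,
  P0 (tstar @^-1` S `&` \bigcap_(t in `I_T.+1) (xi t @^-1` A t)) =
  (P0 (tstar @^-1` S) * \prod_(t < T.+1) P0 (xi t @^-1` A t))%E.
Hypothesis XU : X `<=` U.
Hypothesis G_measurable : jointly_measurable U G.
Hypothesis G_subgradient : forall y, U y -> exists v : 'rV[R]_d,
  (forall i, P.-integrable setT (fun w => (G y w 0 i)%:E) /\
             (\int[P]_w (G y w 0 i)%:E = (v 0 i)%:E)%E) /\
  subdiff f y v.
Hypothesis G_bound : forall y, X y ->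
  (\int[P]_w ((enorm (G y w)) ^+ 2)%:E <= (L ^+ 2)%:E)%E.
Hypothesis X_x0 : X x0.
Hypothesis alpha_ge0 : forall t, (t <= T)%N -> 0 <= alpha t.
Hypothesis alpha_sum_gt0 : 0 < \sum_(t < T.+1) alpha t.
Hypothesis x_init : forall w, x 0%N w = x0.
Hypothesis x_step : forall t, (t <= T)%N -> forall w,
  is_proj X (x t w - alpha t *: G (x t w) (xi t w)) (x t.+1 w).
Hypothesis tstar_measurable : forall t, measurable (tstar @^-1` [set t]).
Hypothesis tstar_law : forall t, (t <= T)%N ->
  P0 (tstar @^-1` [set t]) = (alpha t / \sum_(i < T.+1) alpha i)%:E.

Let dist0 (y : 'rV[R]_d) : R := inner (y - x0) (y - x0).
Let noise t w : 'rV[R]_d := oracle X G (x t w : bvec R d, xi t w).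

Lemma iterate_in t w : (t <= T.+1)%N -> X (x t w).
Proof. by case: t => [_|t tT]; [rewrite x_init|case: (x_step tT w)]. Qed.

Lemma noiseE t w : (t <= T)%N -> noise t w = G (x t w) (xi t w).
Proof. by move=> tT; rewrite /noise /oracle asboolT//; exact/iterate_in/leqW. Qed.

Lemma bvec_axpy_measurable d1 (T1 : measurableType d1) (a : R)
    (y g : T1 -> bvec R d) : measurable_fun setT y -> measurable_fun setT g ->
  measurable_fun setT
    ((fun w => (y w : 'rV[R]_d) - a *: (g w : 'rV[R]_d)) : T1 -> bvec R d).
Proof.
move=> my mg; apply: bvec_measurable => i.
have -> : (fun w => ((y w : 'rV[R]_d) - a *: (g w : 'rV[R]_d)) 0 i) =
    (fun w => (y w : 'rV[R]_d) 0 i - a * (g w : 'rV[R]_d) 0 i).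
  by apply/funext => w; rewrite !mxE.
apply: measurable_funB; first exact: (measurableT_comp (coord_bvec_measurable i)).
apply: measurable_funM => //; exact: (measurableT_comp (coord_bvec_measurable i)).
Qed.

(** By induction, [x t.+1] is a measurable function of [x t] and [xi t]. The projection is
    measurable because it is 1-Lipschitz. *)
Lemma iterate_adapted t : (t <= T.+1)%N ->
  measurable_fun setT (x t : past xi T t -> bvec R d).
Proof.
elim: t => [_|t IH tT].
  have -> : x 0%N = cst x0 by apply/funext => w; exact: x_init.
  exact: measurable_cst.
have /choice[pr prP] := proj_exists X_nonempty X_closed X_convex.
have mpr : measurable_fun setT (pr : bvec R d -> bvec R d).
  apply: (@lipschitz_bvec_measurable _ _ _ 1) => y z; rewrite mul1r.
  exact: (proj_nonexpansive X_convex (prP y) (prP z)).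
have mx : measurable_fun setT (x t : past xi T t.+1 -> bvec R d).
  exact: (past_le (leqnSn t) (IH (ltnW tT))).
have mxi : measurable_fun setT (xi t : past xi T t.+1 -> Omega).
  exact: past_xi.
have mn : measurable_fun setT (noise t : past xi T t.+1 -> bvec R d).
  apply: (measurableT_comp (oracle_measurable X_closed XU G_measurable)).
  exact/measurable_fun_pair.
(* The hypothesis on the step is a relation; uniqueness of the nearest point identifies the iterate
   with the chosen map [pr]. *)
have -> : x t.+1 = pr \o (fun w => x t w - alpha t *: noise t w).
  apply/funext => w /=; rewrite noiseE//.
  apply: (prox_unique _ X_convex (weakly_convex0 (R := R) (d := d)));
    [|exact: is_proj_prox (x_step tT w)|exact: prP].
  by [].
exact: (measurableT_comp mpr (bvec_axpy_measurable _ mx mn)).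
Qed.

Lemma iterate_measurable t : (t <= T.+1)%N ->
  measurable_fun setT (x t : Omega0 -> bvec R d).
Proof. by move=> tT; exact: (past_measurable xi_measurable (iterate_adapted tT)). Qed.

Lemma iterate_indep_xi t (A : set (bvec R d)) B : (t <= T)%N ->
  measurable A -> measurable B ->
  (P0 (x t @^-1` A `&` xi t @^-1` B) = P0 (x t @^-1` A) * P B)%E.
Proof.
move=> tT mA mB; rewrite -(xi_law tT)//.
apply: (past_indep_xi xi_measurable xi_indep tT mB).
by have := iterate_adapted (leqW tT) measurableT mA; rewrite setTI.
Qed.

Lemma iterate_indep_tstar t (A : set (bvec R d)) (S : set nat) : (t <= T)%N ->
  measurable A ->
  (P0 (x t @^-1` A `&` tstar @^-1` S) = P0 (x t @^-1` A) * P0 (tstar @^-1` S))%E.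
Proof.
move=> tT mA.
apply: (past_indep_tstar (t := t) xi_measurable tstar_measurable xi_indep).
by have := iterate_adapted (leqW tT) measurableT mA; rewrite setTI.
Qed.

Lemma noise_measurable t : (t <= T)%N ->
  measurable_fun setT (noise t : Omega0 -> bvec R d).
Proof.
move=> tT; apply: (measurableT_comp (oracle_measurable X_closed XU G_measurable)).
by apply/measurable_fun_pair => //; exact/iterate_measurable/leqW.
Qed.

Lemma noise_second_moment t : (t <= T)%N ->
  (\int[P0]_w (inner (noise t w) (noise t w))%:E <= (L ^+ 2)%:E)%E.
Proof.
move=> tT.
have := @indep_integral2_le R _ _ _ _ _ _ P0 P
  (x t : Omega0 -> bvec R d) (xi t)
  (fun p => (inner (oracle X G p : 'rV[R]_d) (oracle X G p : 'rV[R]_d))%:E)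
  (fun=> (L ^+ 2)%:E).
rewrite integral_cst// [X in (_ * X)%E]probability_setT mule1; apply=> //.
- exact/iterate_measurable/leqW.
- by move=> A B; exact: iterate_indep_xi.
- apply/measurable_EFinP; apply: inner_measurable; exact: oracle_measurable XU _.
- by move=> p; rewrite lee_fin inner_ge0.
- move=> w; have Xx := iterate_in w (leqW tT); apply: le_trans (G_bound Xx).
  rewrite le_eqVlt; apply/orP; left; apply/eqP; apply: eq_integral => z _.
  by rewrite enormK /oracle asboolT.
Qed.

Lemma iterate_L2 t : (t <= T.+1)%N ->
  P0.-integrable setT (fun w => (dist0 (x t w))%:E).
Proof.
have mdist s : (s <= T.+1)%N -> measurable_fun setT (fun w => (dist0 (x s w))%:E).
  move=> sT; apply/measurable_EFinP.
  have mx := iterate_measurable sT.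
  have ms : measurable_fun setT ((fun w => x s w - 1 *: x0) : Omega0 -> bvec R d).
    by apply: bvec_axpy_measurable => //; exact: measurable_cst.
  have := inner_measurable ms ms.
  by under eq_fun do rewrite scale1r.
have idist s : (s <= T.+1)%N -> (\int[P0]_w (dist0 (x s w))%:E < +oo)%E ->
    P0.-integrable setT (fun w => (dist0 (x s w))%:E).
  move=> sT lty; apply/integrableP; split; first exact: mdist.
  apply: le_lt_trans lty; rewrite le_eqVlt; apply/orP; left; apply/eqP.
  by apply: eq_integral => w _; rewrite gee0_abs// lee_fin inner_ge0.
elim: t => [_|t IH tT].
  apply: idist => //; under eq_integral do rewrite x_init.
  by rewrite integral_cst// [X in (_ * X)%E]probability_setT mule1 ltry.
apply: idist => //.
have i1 := IH (ltnW tT).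
(* Since [x0] is its own projection, |x_{t+1} - x0| <= |x_t - x0 - alpha_t noise_t|, and |u - v|^2
   <= 2|u|^2 + 2|v|^2. *)
apply: (@le_lt_trans _ _ (\int[P0]_w (2%:E * (dist0 (x t w))%:E +
    (2 * alpha t ^+ 2)%:E * (inner (noise t w) (noise t w))%:E))%E).
  apply: ge0_le_integral => //.
  - by move=> w _; rewrite lee_fin inner_ge0.
  - exact: mdist.
  - apply: emeasurable_funD; apply: measurable_funeM; first exact/mdist/ltnW.
    by apply/measurable_EFinP/inner_measurable; exact: noise_measurable.
  - move=> w _; rewrite -!EFinM -EFinD lee_fin.
    have := proj_nonexpansive X_convex (is_proj_prox (x_step tT w)) (proj_id X_x0).
    rewrite -/(dist0 (x t.+1 w)) -noiseE// => /le_trans; apply.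
    have := inner_ge0 (x t w - x0 + alpha t *: noise t w).
    rewrite (_ : x t w - alpha t *: noise t w - x0 =
      (x t w - x0) - alpha t *: noise t w); last by rewrite addrAC.
    rewrite /dist0; move: (x t w - x0) (noise t w) => u n.
    by rewrite !innerE (innerC n u); nra.
rewrite ge0_integralD//; last 4 first.
- by move=> w _; rewrite -EFinM lee_fin mulr_ge0 ?inner_ge0.
- by apply: measurable_funeM; exact/mdist/ltnW.
- by move=> w _; rewrite -EFinM lee_fin mulr_ge0 ?inner_ge0// mulr_ge0// sqr_ge0.
- by apply/measurable_funeM/measurable_EFinP/inner_measurable; exact: noise_measurable.
rewrite integralZl// ge0_integralZl_EFin//; last 3 first.
- by move=> w _; rewrite lee_fin inner_ge0.
- by apply/measurable_EFinP/inner_measurable; exact: noise_measurable.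
- by rewrite mulr_ge0// sqr_ge0.
rewrite lte_add_pinfty//.
  by rewrite lte_mul_pinfty// ?lee_fin//; exact: integrable_lty.
apply: lte_mul_pinfty => //; first by rewrite lee_fin mulr_ge0// sqr_ge0.
exact: le_lt_trans (noise_second_moment tT) (ltry _).
Qed.

(** The envelope and the squared residual both grow at most quadratically around [x0], so square
    integrability of the iterates suffices for both. *)
Lemma quadratic_integrable (h : 'rV[R]_d -> R) (a b : R) t : (t <= T.+1)%N ->
  measurable_fun setT (h : bvec R d -> R) ->
  (forall y, `|h y| <= a + b * dist0 y) ->
  P0.-integrable setT (fun w => (h (x t w))%:E).
Proof.
move=> tT mh hab.
apply: (@le_integrable _ _ _ P0 _ measurableT _
  (fun w => (a%:E + b%:E * (dist0 (x t w))%:E)%E)).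
- by apply/measurable_EFinP; exact: (measurableT_comp mh (iterate_measurable tT)).
- move=> w _; rewrite -EFinM -EFinD !abse_EFin lee_fin (le_trans (hab _))//.
  exact: ler_norm.
- apply: integrableD => //; first exact: finite_measure_integrable_cst.
  by apply: integrableZl => //; exact: iterate_L2.
Qed.

(** * One-step descent, telescoping and the random index *)

Section Descent.
Variable rb : R.
Hypothesis rho_lt_rb : rho < rb.
Let F := moreau (phi_of f X) rb^-1.
Let gradsq (y : 'rV[R]_d) : R := enorm (grad F y) ^+ 2.

Let rb_gt0 : 0 < rb.
Proof. exact: lt_trans rho_lt_rb. Qed.

Let c_gt0 : 0 < rb - rho.
Proof. by rewrite subr_gt0. Qed.

Lemma oracle_subgradient y : X y -> exists v : 'rV[R]_d,
  (forall i, P.-integrable setT (fun w => (G y w 0 i)%:E) /\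
             (\int[P]_w (G y w 0 i)%:E = (v 0 i)%:E)%E) /\
  forall z, f y + inner v (z - y) - rho / 2 * inner (z - y) (z - y) <= f z.
Proof.
move=> /XU/G_subgradient[v [vi fv]]; exists v; split=> // z.
exact: subdiff_ineq (ltW rho_gt0) f_wc _ _ _ fv.
Qed.

Lemma has_subgradient y : X y -> exists v, forall z, X z ->
  f y + inner v (z - y) - rho / 2 * inner (z - y) (z - y) <= f z.
Proof. by move=> /oracle_subgradient[v [_ fv]]; exists v => z _; exact: fv. Qed.

Lemma prox_fun : exists px : 'rV[R]_d -> 'rV[R]_d, forall z, is_prox X f rb z (px z).
Proof.
have /choice[px pxP] :=
  prox_exists rho_lt_rb X_convex f_wc X_nonempty X_closed has_subgradient.
by exists px.
Qed.

Lemma gradsqE z p : is_prox X f rb z p -> gradsq z = rb ^+ 2 * inner (z - p) (z - p).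
Proof.
move=> zp; rewrite /gradsq enormK.
rewrite (moreau_grad rb_gt0 rho_lt_rb X_convex f_wc X_nonempty X_closed has_subgradient zp).
by rewrite innerZl innerZr mulrA.
Qed.

Let K := rb * ((rb / (rb - rho)) ^+ 2 + 1) / 2.

Lemma moreau_quadratic px : (forall z, is_prox X f rb z (px z)) ->
  forall y z, `|F z - F y - inner (rb *: (y - px y)) (z - y)| <= K * inner (z - y) (z - y).
Proof.
by move=> pxP y z; rewrite innerZl; exact: moreau_expansion (pxP y) (pxP z).
Qed.

Lemma moreau_measurable : measurable_fun setT (F : bvec R d -> R).
Proof.
by have [px pxP] := prox_fun; apply: quadratic_bvec_measurable (moreau_quadratic pxP).
Qed.

Lemma moreau_integrable t : (t <= T.+1)%N ->
  P0.-integrable setT (fun w => (F (x t w))%:E).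
Proof.
move=> tT; have [px pxP] := prox_fun.
set g := rb *: (x0 - px x0).
(* The constants come from expanding the envelope at [x0]: the remainder gives [K], and Young's
   inequality splits the linear term into halves. *)
apply: (@quadratic_integrable _ (`|F x0| + inner g g / 2) (K + 1 / 2)) => //.
  exact: moreau_measurable.
move=> y; have h1 := moreau_quadratic pxP x0 y; have h2 := inner_bound g (y - x0).
have -> : F y = (F y - F x0 - inner g (y - x0)) + F x0 + inner g (y - x0) by ring.
rewrite (le_trans (ler_normD _ _))// (le_trans (lerD (ler_normD _ _) (lexx _)))//.
by rewrite /dist0; move: h1 h2; rewrite -/g; lra.
Qed.

Lemma residual_measurable px : (forall z, is_prox X f rb z (px z)) ->
  measurable_fun setT ((fun y => (y : 'rV[R]_d) - px y) : bvec R d -> bvec R d).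
Proof.
move=> pxP.
have mpx : measurable_fun setT (px : bvec R d -> bvec R d).
  apply: (@lipschitz_bvec_measurable _ _ _ ((rb / (rb - rho)) ^+ 2)) => y z.
  have := prox_lipschitz rho_lt_rb X_convex f_wc (pxP y) (pxP z).
  by rewrite -ler_pdivlMl ?exprn_gt0// mulrA -exprVn -exprMn (mulrC _ rb).
have := bvec_axpy_measurable 1 (@measurable_id _ (bvec R d) setT) mpx.
congr measurable_fun; apply/funext => y.
by rewrite scale1r.
Qed.

Lemma residual_sqr_measurable px : (forall z, is_prox X f rb z (px z)) ->
  measurable_fun setT ((fun y => inner (y - px y) (y - px y)) : bvec R d -> R).
Proof.
by move=> pxP; exact: inner_measurable (residual_measurable pxP) (residual_measurable pxP).
Qed.

Lemma residual_integrable px t : (forall z, is_prox X f rb z (px z)) ->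
  (t <= T.+1)%N ->
  P0.-integrable setT (fun w => (inner (x t w - px (x t w)) (x t w - px (x t w)))%:E).
Proof.
move=> pxP tT.
pose C := (rb / (rb - rho)) ^+ 2.
(* With u the residual at [x0], v = y - x0 and w the increment of the proximal map: |u + (v - w)|^2
   <= 2|u|^2 + 4|v|^2 + 4|w|^2 and |w|^2 <= C|v|^2. *)
apply: (@quadratic_integrable (fun y => inner (y - px y) (y - px y))
  (2 * inner (x0 - px x0) (x0 - px x0)) (4 + 4 * C)) => //.
  exact: residual_sqr_measurable.
move=> y; rewrite ger0_norm ?inner_ge0//.
have := prox_lipschitz rho_lt_rb X_convex f_wc (pxP y) (pxP x0).
rewrite -ler_pdivlMl ?exprn_gt0// mulrA -exprVn -exprMn (mulrC _ rb) -/C -/(dist0 y).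
rewrite (_ : y - px y = (x0 - px x0) + ((y - x0) - (px y - px x0))); last first.
  by apply/rowP => i; rewrite !mxE; ring.
rewrite /dist0; move: (x0 - px x0) (y - x0) (px y - px x0) => u v w h.
have := inner_ge0 (u - (v - w)); have := inner_ge0 (v + w).
rewrite !innerE (innerC v u) (innerC w u) (innerC w v).
set uu := inner u u; set vv := inner v v; set ww := inner w w in h *.
set uv := inner u v; set uw := inner u w; set vw := inner v w.
by move: h; rewrite -/vv; lra.
Qed.

Lemma gradsq_integrable t : (t <= T.+1)%N ->
  P0.-integrable setT (fun w => (gradsq (x t w))%:E).
Proof.
move=> tT; have [px pxP] := prox_fun.
under eq_fun do rewrite (gradsqE (pxP _)) EFinM.
by apply: integrableZl => //; exact: residual_integrable.
Qed.

Lemma gradsq_measurable : measurable_fun setT (gradsq : bvec R d -> R).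
Proof.
have [px pxP] := prox_fun.
rewrite (_ : gradsq = fun y => rb ^+ 2 * inner (y - px y) (y - px y)); last first.
  by apply/funext => y; exact: gradsqE.
by apply: measurable_funM => //; exact: residual_sqr_measurable.
Qed.

(* The inner product with the mean subgradient is controlled by the
   strong growth of the proximal objective at its minimizer. *)
Lemma expected_prox_distance y p (a : R) : X y -> is_prox X f rb y p -> 0 <= a ->
  (\int[P]_w (rb / 2 * inner (y - p - a *: G y w) (y - p - a *: G y w))%:E <=
   ((rb / 2 - a * rb * (rb - rho)) * inner (y - p) (y - p)
     + a ^+ 2 * rb * L ^+ 2 / 2)%:E)%E.
Proof.
move=> Xy yp a0; have [v [vi fv]] := oracle_subgradient Xy.
have h1 := oracle_second_moment (y - p) a vi (G_bound Xy).
have mG : measurable_fun setT (fun w => (inner (y - p - a *: G y w) (y - p - a *: G y w))%:E).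
  have mGy : measurable_fun setT (G y : Omega -> bvec R d).
    apply: bvec_measurable => i; apply/measurable_EFinP.
    by case: (vi i) => /integrableP[].
  have m1 := bvec_axpy_measurable a (@measurable_cst _ _ Omega (bvec R d) setT (y - p)) mGy.
  exact/measurable_EFinP/(inner_measurable m1 m1).
under eq_integral do rewrite EFinM.
rewrite ge0_integralZl_EFin//; last 2 first.
- by move=> w _; rewrite lee_fin inner_ge0.
- by rewrite divr_ge0// ltW.
have rb2 : (0 <= (rb / 2)%:E)%E by rewrite lee_fin divr_ge0// ltW.
apply: (le_trans (lee_wpmul2l rb2 h1)).
rewrite -EFinM lee_fin.
have h2 := fv p; have h3 := prox_growth rho_lt_rb X_convex f_wc yp Xy.
have E : inner (p - y) (p - y) = inner (y - p) (y - p).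
  by rewrite -opprB innerNl innerNr opprK.
have E2 : inner v (p - y) = - inner v (y - p) by rewrite -opprB innerNr.
move: h2 h3; rewrite subrr inner0r mulr0 addr0 E E2.
set N := inner (y - p) (y - p); set I := inner v (y - p) => h2 h3.
(* The values of [f] cancel in the sum of [h2] and [h3], and the coefficients rb/2, (rb-rho)/2 and
   -rho/2 of [N] add up to rb - rho. *)
have h4 : (rb - rho) * N <= I by lra.
have := ler_wpM2l (mulr_ge0 (ltW rb_gt0) a0) h4.
by set L2 := L ^+ 2; lra.
Qed.

Lemma expected_descent t : (t <= T)%N ->
  \int[P0]_w F (x t.+1 w) <= \int[P0]_w F (x t w)
    - alpha t * (rb - rho) / rb * (\int[P0]_w gradsq (x t w))
    + alpha t ^+ 2 * rb * L ^+ 2 / 2.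
Proof.
move=> tT; have [px pxP] := prox_fun.
have tT1 := leqW tT.
pose N (y : 'rV[R]_d) := inner (y - px y) (y - px y).
pose h (p : bvec R d * Omega) : \bar R :=
  (rb / 2 * inner ((p.1 : 'rV[R]_d) - px p.1 - alpha t *: oracle X G p)
                  ((p.1 : 'rV[R]_d) - px p.1 - alpha t *: oracle X G p))%:E.
pose H w := rb / 2 * inner (x t w - px (x t w) - alpha t *: noise t w)
                           (x t w - px (x t w) - alpha t *: noise t w).
pose M y := (rb / 2 - alpha t * rb * (rb - rho)) * N y + alpha t ^+ 2 * rb * L ^+ 2 / 2.
have mN := residual_sqr_measurable pxP.
have iN : P0.-integrable setT (EFin \o (fun w => N (x t w))) by exact: residual_integrable.
have iF : P0.-integrable setT (EFin \o (fun w => F (x t w))) by exact: moreau_integrable.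
have iF1 : P0.-integrable setT (EFin \o (fun w => F (x t.+1 w))) by exact: moreau_integrable.
have h0 p : (0 <= h p)%E by rewrite lee_fin mulr_ge0 ?inner_ge0// divr_ge0// ltW.
have mh : measurable_fun [set: bvec R d * Omega] h.
  apply/measurable_EFinP; apply: measurable_funM => //.
  have m1 : measurable_fun [set: bvec R d * Omega]
      ((fun p => (p.1 : 'rV[R]_d) - px p.1) : bvec R d * Omega -> bvec R d).
    exact: (measurableT_comp (residual_measurable pxP) measurable_fst).
  have m2 := bvec_axpy_measurable (alpha t) m1
    (oracle_measurable X_closed XU G_measurable).
  exact: (inner_measurable m2 m2).
have mM : measurable_fun setT ((fun y => (M y)%:E) : bvec R d -> \bar R).
  apply/measurable_EFinP; apply: measurable_funD => //.
  by apply: measurable_funM.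
have HM : (\int[P0]_w (H w)%:E <= \int[P0]_w (M (x t w))%:E)%E.
  apply: (@indep_integral2_le R _ _ _ _ _ _ P0 P (x t : Omega0 -> bvec R d) (xi t)
    h (fun y => (M y)%:E)) => //.
  - exact: iterate_measurable.
  - by move=> A B; exact: iterate_indep_xi.
  - move=> w; have Xx := iterate_in w tT1.
    apply: le_trans (expected_prox_distance Xx (pxP _) (alpha_ge0 tT)).
    rewrite le_eqVlt; apply/orP; left; apply/eqP; apply: eq_integral => z _.
    by rewrite /h /oracle asboolT.
have iK : P0.-integrable setT (EFin \o cst (alpha t ^+ 2 * rb * L ^+ 2 / 2)).
  exact: finite_measure_integrable_cst.
have iZN (k : R) : P0.-integrable setT (EFin \o (fun w => k * N (x t w))).
  exact: (integrableZl measurableT k iN).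
have iM : P0.-integrable setT (EFin \o (fun w => M (x t w))).
  exact: (integrableD measurableT (iZN _) iK).
(* Integrability of [H] is a consequence of the Tonelli bound: [H] is nonnegative and its integral
   is at most the finite integral of [M]. *)
have iH : P0.-integrable setT (EFin \o H).
  apply/integrableP; split.
    have mYZ : measurable_fun setT
        ((fun w => (x t w, xi t w)) : Omega0 -> bvec R d * Omega).
      by apply/measurable_fun_pair => //; exact: iterate_measurable.
    exact: (measurableT_comp mh mYZ).
  apply: (@le_lt_trans _ _ (\int[P0]_w (M (x t w))%:E)%E); last exact: integrable_lty.
  apply: le_trans HM; rewrite le_eqVlt; apply/orP; left; apply/eqP.
  apply: eq_integral => w _; rewrite gee0_abs// lee_fin.
  by rewrite mulr_ge0 ?inner_ge0// divr_ge0// ltW.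
have HM' : \int[P0]_w H w <= \int[P0]_w M (x t w).
  by rewrite /Rintegral fine_le//; exact: integrable_fin_num.
have EM : \int[P0]_w M (x t w) = (rb / 2 - alpha t * rb * (rb - rho)) *
    (\int[P0]_w N (x t w)) + alpha t ^+ 2 * rb * L ^+ 2 / 2.
  rewrite (RintegralD measurableT (iZN _) iK) RintegralZl//.
  by rewrite Rintegral_cst// [X in fine X]probability_setT mulr1.
have Egrad : \int[P0]_w gradsq (x t w) = rb ^+ 2 * (\int[P0]_w N (x t w)).
  by rewrite -RintegralZl//; apply: eq_Rintegral => w _; rewrite (gradsqE (pxP _)).
have iFN : P0.-integrable setT (EFin \o (fun w => F (x t w) + (- (rb / 2)) * N (x t w))).
  exact: (integrableD measurableT iF (iZN _)).
(* The difference F(x_t) - rb/2 N(x_t) is the value of [f] at the proximal point of x_t; it is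
   written this way because its two terms are known to be integrable. *)
have key : \int[P0]_w F (x t.+1 w) <=
    \int[P0]_w (F (x t w) + (- (rb / 2)) * N (x t w) + H w).
  apply: le_Rintegral => //; first exact: (integrableD measurableT iFN iH).
  move=> w _; rewrite /F (moreau_proxE rb_gt0 (pxP (x t w))).
  set p := px (x t w).
  have Xp : X p by case: (pxP (x t w)).
  apply: (le_trans (moreau_le rb_gt0 (pxP _) Xp)).
  have := proj_nonexpansive X_convex (is_proj_prox (x_step tT w)) (proj_id Xp).
  rewrite -noiseE// => h1.
  have E1 : inner (p - x t.+1 w) (p - x t.+1 w) = inner (x t.+1 w - p) (x t.+1 w - p).
    by rewrite -opprB innerNl innerNr opprK.
  have E2 : inner (p - x t w) (p - x t w) = N (x t w).
    by rewrite -opprB innerNl innerNr opprK.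
  rewrite E1 E2 /H -/p; move: h1; rewrite addrAC => h1.
  have rb2 : 0 <= rb / 2 by rewrite divr_ge0// ltW.
  by have := ler_wpM2l rb2 h1; lra.
move: key; rewrite (RintegralD measurableT iFN iH) (RintegralD measurableT iF (iZN _)).
rewrite RintegralZl// Egrad => key.
have rbE : alpha t * (rb - rho) / rb * (rb ^+ 2 * (\int[P0]_w N (x t w))) =
  alpha t * rb * (rb - rho) * (\int[P0]_w N (x t w)) by field; rewrite gt_eqF.
by rewrite EM in HM'; rewrite rbE; exact: descent_combine HM' key.
Qed.

Lemma descent_telescope n : (n <= T.+1)%N ->
  (rb - rho) / rb * (\sum_(t < n) alpha t * (\int[P0]_w gradsq (x t w))) <=
  F x0 - \int[P0]_w F (x n w) + rb * L ^+ 2 / 2 * \sum_(t < n) alpha t ^+ 2.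
Proof.
elim: n => [_|n IH nT].
  have -> : \int[P0]_w F (x 0%N w) = \int[P0]_w F x0.
    by apply: eq_Rintegral => w _; rewrite x_init.
  rewrite !big_ord0 !mulr0 addr0.
  by rewrite Rintegral_cst// [X in fine X]probability_setT mulr1 subrr.
rewrite !big_ord_recr/=; have := IH (ltnW nT); have := expected_descent nT.
exact: telescope_combine.
Qed.

(** The prescribed weights on 0, ..., T already add up to 1. Beyond [T.+1] the family [x] is
    unconstrained, so this event must be discarded. *)
Lemma tstar_null : P0 (tstar @^-1` [set k | (T < k)%N]) = 0%E.
Proof.
have mS S : measurable (tstar @^-1` S) by exact: tstar_preimage_measurable.
have -> : tstar @^-1` [set k | (T < k)%N] = ~` (tstar @^-1` `I_T.+1).
  by apply/seteqP; split=> w /=; [rewrite ltnNge ltnS => /negP|move/negP; rewrite ltnS -ltnNge].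
rewrite probability_setC//.
have -> : tstar @^-1` `I_T.+1 = \big[setU/set0]_(t < T.+1) (tstar @^-1` [set nat_of_ord t]).
  rewrite -(bigcup_mkord T.+1 (fun t => tstar @^-1` [set t])).
  by apply/seteqP; split=> [w /= wT|w [t /= tT]]; [exists (tstar w)|rewrite /preimage/= => ->].
rewrite measure_semi_additive_ord//; last 2 first.
- apply/trivIsetP => i j _ _ ij; rewrite -preimage_setI.
  by apply/seteqP; split=> // w [/= -> /val_inj] => /eqP; rewrite (negbTE ij).
- by apply: bigsetU_measurable.
rewrite (eq_bigr (fun t : 'I_T.+1 => (alpha t / \sum_(i < T.+1) alpha i)%:E)); last first.
  by move=> t _; rewrite -tstar_law// -ltnS.
by rewrite sumEFin -mulr_suml divff ?gt_eqF// subee.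
Qed.

(** Independence of [x t] and [tstar] gives an integral against a product law, whose inner integral
    is the probability of [t]. *)
Lemma gradsq_tstar_term t : (t <= T)%N ->
  (\int[P0]_w ((gradsq (x t w))%:E * (\1_[set t] (tstar w))%:E) =
   (\int[P0]_w gradsq (x t w) * (alpha t / \sum_(i < T.+1) alpha i))%:E)%E.
Proof.
move=> tT.
have mt : measurable_fun setT tstar.
  by move=> _ B _; rewrite setTI; exact: tstar_preimage_measurable.
pose tstar' : {mfun Omega0 >-> nat} :=
  HB.pack tstar (isMeasurableFun.Build _ _ _ _ _ mt).
pose h (p : bvec R d * nat) : \bar R := ((gradsq p.1)%:E * (\1_[set t] p.2)%:E)%E.
have h0 p : (0 <= h p)%E by rewrite /h -EFinM lee_fin mulr_ge0// sqr_ge0.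
have mh : measurable_fun [set: bvec R d * nat] h.
  apply: emeasurable_funM; apply/measurable_EFinP.
    exact: (measurableT_comp gradsq_measurable measurable_fst).
  have mi : measurable_fun setT (\1_[set t] : nat -> R) by [].
  exact: (measurableT_comp mi measurable_snd).
rewrite (@indep_integral2 R _ _ _ _ _ _ P0 (distribution P0 tstar')
  (x t : Omega0 -> bvec R d) tstar h)//; last 2 first.
- exact/iterate_measurable/leqW.
- by move=> A B mA _; exact: iterate_indep_tstar.
have ig := gradsq_integrable (leqW tT).
rewrite EFinM /Rintegral fineK ?integrable_fin_num// -integralZr//.
apply: eq_integral => w _; rewrite /h/=.
rewrite ge0_integralZl_EFin ?sqr_ge0//.
by rewrite integral_indic// setIT -tstar_law.
Qed.

(** The integrand is split by the value of [tstar]. As it may fail to be measurable on the null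
    event, it is only compared from above. *)
Lemma gradsq_tstar :
  (\int[P0]_w (gradsq (x (tstar w) w))%:E <=
   ((\sum_(t < T.+1) alpha t * (\int[P0]_w gradsq (x t w))) /
      \sum_(t < T.+1) alpha t)%:E)%E.
Proof.
pose g t w := ((gradsq (x t w))%:E * (\1_[set t] (tstar w))%:E)%E.
have g0 t w : (0 <= g t w)%E by rewrite /g -EFinM lee_fin mulr_ge0// sqr_ge0.
have mt : measurable_fun setT tstar.
  by move=> _ B _; rewrite setTI; exact: tstar_preimage_measurable.
have mg (t : 'I_T.+1) : measurable_fun setT (g t).
  apply: emeasurable_funM; apply/measurable_EFinP.
    apply: (measurableT_comp gradsq_measurable).
    by apply: iterate_measurable; exact: ltnW.
  have mi : measurable_fun setT (\1_[set (t : nat)] : nat -> R) by [].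
  exact: (measurableT_comp mi mt).
apply: (@le_trans _ _ (\int[P0]_w (\sum_(t < T.+1) g t w))%E).
  apply: (integral_le_off_null (N := tstar @^-1` [set k | (T < k)%N])) => //.
  - exact: tstar_preimage_measurable.
  - exact: tstar_null.
  - by move=> w; rewrite lee_fin sqr_ge0.
  - exact: emeasurable_sum.
  - by move=> w; apply: sume_ge0.
  - move=> w /negP; rewrite -leqNgt -ltnS => wT.
    rewrite (bigD1 (Ordinal wT))//= {1}/g indicE mem_set// mule1 leeDl//.
    by apply: sume_ge0.
rewrite ge0_integral_sum//.
rewrite (eq_bigr (fun t : 'I_T.+1 => (\int[P0]_w gradsq (x t w) *
  (alpha t / \sum_(i < T.+1) alpha i))%:E)); last first.
  by move=> t _; rewrite gradsq_tstar_term// -ltnS.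
rewrite sumEFin lee_fin mulr_suml.
by apply: ler_sum => t _; rewrite mulrA (mulrC (alpha t)).
Qed.

Lemma min_ext_ltpinfty : min_ext (phi_of f X) != +oo%E.
Proof.
rewrite -ltey; apply: (@le_lt_trans _ _ (f x0)%:E); last by rewrite ltry.
by apply: ereal_inf_lbound; exists x0 => //; rewrite /phi_of asboolT.
Qed.

Lemma expected_gradsq_le :
  (\int[P0]_w (gradsq (x (tstar w) w))%:E <=
      (rb / (rb - rho) / \sum_(t < T.+1) alpha t)%:E *
      ((F x0)%:E - min_ext (phi_of f X)
       + (rb * L ^+ 2 / 2 * \sum_(t < T.+1) alpha t ^+ 2)%:E))%E.
Proof.
have C0 : 0 < rb / (rb - rho) / \sum_(t < T.+1) alpha t.
  by rewrite divr_gt0// divr_gt0.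
have := min_ext_ltpinfty; have := @min_le_moreau _ _ X f _ rb_gt0.
(* If the minimum is [-oo], the right-hand side is [+oo], its leading factor being positive. *)
case: (min_ext _) => [m|//|] Fm _; last first.
  by rewrite /= addey// addye// gt0_muley ?leey// lte_fin.
have [px pxP] := prox_fun.
apply: (le_trans gradsq_tstar); rewrite -EFinB -EFinD -EFinM lee_fin.
(* The envelope never falls below the minimum, so the final expectation left by telescoping can be
   replaced by [m]. *)
have h1 : m <= \int[P0]_w F (x T.+1 w).
  rewrite -[m]mulr1 -[1](_ : fine (P0 setT) = 1); last by rewrite probability_setT.
  rewrite -Rintegral_cst//; apply: le_Rintegral => //.
  - exact: finite_measure_integrable_cst.
  - exact: moreau_integrable.
  - by move=> w _; rewrite -lee_fin; exact: Fm (pxP _).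
have := descent_telescope (leqnn _).
set S1 := \sum_(t < T.+1) _ * _; set S2 := \sum_(t < T.+1) _ ^+ 2.
set S := \sum_(t < T.+1) alpha t => h2.
rewrite mulrAC ler_pM2r ?invr_gt0//.
rewrite -ler_pdivrMl ?divr_gt0// invf_div.
by apply: (le_trans h2); rewrite lerD2r lerD2l lerN2.
Qed.

End Descent.

End StochasticSubgradient.

(** * Transfer to extended-valued expectations and the constant stepsize *)

Unset Implicit Arguments.
Set Strict Implicit.
Set Printing Implicit Defensive.

Theorem theorem3p1
  (R : realType) (d : nat)
  (rho : R) (X : set 'rV[R]_d) (f : 'rV[R]_d -> R)
  (* (A1)-(A3): the oracle *)
  (dO : measure_display) (Omega : measurableType dO) (P : probability Omega R)
  (U : set 'rV[R]_d) (G : 'rV[R]_d -> Omega -> 'rV[R]_d) (L : R)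
  (* underlying probability space carrying xi_0, xi_1, ... and t^* *)
  (d0 : measure_display) (Omega0 : measurableType d0) (P0 : probability Omega0 R)
  (xi : nat -> Omega0 -> Omega) (tstar : Omega0 -> nat)
  (T : nat) (x0 : 'rV[R]_d) (alpha : nat -> R)
  (x : nat -> Omega0 -> 'rV[R]_d) :
  0 < rho ->
  X !=set0 -> closed X -> convex_set_of X ->
  weakly_convex rho f ->
  (* (A1) *)
  (forall t, measurable_fun setT (xi t)) ->
  (forall t, (t <= T)%N -> forall A, measurable A -> P0 (xi t @^-1` A) = P A) ->
  (forall A : nat -> set Omega, (forall t, measurable (A t)) -> forall S : set nat,
      P0 (tstar @^-1` S `&` \bigcap_(t in `I_T.+1) (xi t @^-1` A t)) =
      (P0 (tstar @^-1` S) * \prod_(t < T.+1) P0 (xi t @^-1` A t))%E) ->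
  (* (A2) *)
  open U -> X `<=` U -> jointly_measurable U G ->
  (forall y, U y -> exists v : 'rV[R]_d,
      (forall i, P.-integrable setT (fun w => (G y w 0 i)%:E) /\
                 (\int[P]_w (G y w 0 i)%:E = (v 0 i)%:E)%E) /\
      subdiff f y v) ->
  (* (A3) *)
  0 <= L ->
  (forall y, X y -> (\int[P]_w ((enorm (G y w)) ^+ 2)%:E <= (L ^+ 2)%:E)%E) ->
  (* the algorithm *)
  X x0 ->
  (forall t, (t <= T)%N -> 0 <= alpha t) ->
  0 < \sum_(t < T.+1) alpha t ->
  (forall w, x 0%N w = x0) ->
  (forall t, (t <= T)%N -> forall w,
      is_proj X (x t w - alpha t *: G (x t w) (xi t w)) (x t.+1 w)) ->
  (forall t, measurable (tstar @^-1` [set t])) ->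
  (forall t, (t <= T)%N ->
      P0 (tstar @^-1` [set t]) = (alpha t / \sum_(i < T.+1) alpha i)%:E) ->
  let phi := phi_of f X in
  (forall rb : R, rho < rb ->
    (forall t, (t <= T)%N ->
      (\int[P0]_w (moreau phi rb^-1 (x t.+1 w))%:E <=
       \int[P0]_w (moreau phi rb^-1 (x t w))%:E
       - (alpha t * (rb - rho) / rb)%:E *
           \int[P0]_w ((enorm (grad (moreau phi rb^-1) (x t w))) ^+ 2)%:E
       + (alpha t ^+ 2 * rb * L ^+ 2 / 2)%:E)%E) /\
    (\int[P0]_w ((enorm (grad (moreau phi rb^-1) (x (tstar w) w))) ^+ 2)%:E <=
      (rb / (rb - rho) / \sum_(t < T.+1) alpha t)%:E *
      ((moreau phi rb^-1 x0)%:E - min_ext phi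
       + (rb * L ^+ 2 / 2 * \sum_(t < T.+1) alpha t ^+ 2)%:E))%E) /\
  (forall gamma : R, 0 < gamma ->
    (forall t, (t <= T)%N -> alpha t = gamma / Num.sqrt (T.+1)%:R) ->
    (\int[P0]_w ((enorm (grad (moreau phi (2 * rho)^-1) (x (tstar w) w))) ^+ 2)%:E <=
      (2 / (gamma * Num.sqrt (T.+1)%:R))%:E *
      ((moreau phi (2 * rho)^-1 x0)%:E - min_ext phi
       + (rho * L ^+ 2 * gamma ^+ 2)%:E))%E).
Proof.
move=> rho_gt0 X_ne X_cl X_cv f_wc mxi xi_law xi_ind _ XU mG subG _ bG Xx0 al0 alS.
move=> xinit xstep mt tlaw phi.
have main rb (hrb : rho < rb) := expected_gradsq_le rho_gt0 X_ne X_cl X_cv f_wc mxi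
  xi_law xi_ind XU mG subG bG Xx0 al0 alS xinit xstep mt tlaw hrb.
split=> [rb hrb|gamma g0 alE].
  split; last exact: main.
  move=> t tT.
  (* Integrability makes the expectations finite, so the extended-valued inequality reduces to the
     real one. *)
  have eF s : (s <= T.+1)%N -> (\int[P0]_w (moreau phi rb^-1 (x s w))%:E =
      (\int[P0]_w moreau phi rb^-1 (x s w))%R%:E)%E.
    move=> sT; rewrite fineK//; apply: integrable_fin_num => //.
    exact: (moreau_integrable rho_gt0 X_ne X_cl X_cv f_wc mxi xi_law xi_ind XU mG subG
      bG Xx0 xinit xstep hrb sT).
  have eG : (\int[P0]_w (enorm (grad (moreau phi rb^-1) (x t w)) ^+ 2)%:E =
      (\int[P0]_w (enorm (grad (moreau phi rb^-1) (x t w)) ^+ 2))%R%:E)%E.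
    rewrite fineK//; apply: integrable_fin_num => //.
    exact: (gradsq_integrable rho_gt0 X_ne X_cl X_cv f_wc mxi xi_law xi_ind XU mG
      subG bG Xx0 xinit xstep hrb (leqW tT)).
  rewrite (eF t.+1 tT) (eF t (leqW tT)) eG -EFinM -EFinB -EFinD lee_fin.
  exact: (expected_descent rho_gt0 X_ne X_cl X_cv f_wc mxi xi_law xi_ind XU mG subG
    bG Xx0 al0 xinit xstep hrb tT).
have rho2 : rho < 2 * rho by rewrite ltr_pMl// ltr1n.
have n0 : 0 < Num.sqrt T.+1%:R :> R by rewrite sqrtr_gt0 ltr0n.
(* Writing T+1 as the square of its root turns the sum of the constant stepsizes into gamma
   sqrt(T+1) and the sum of their squares into gamma^2. *)
have nE : T.+1%:R = Num.sqrt T.+1%:R ^+ 2 :> R by rewrite sqr_sqrtr.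
have alE' (t : 'I_T.+1) : alpha t = gamma / Num.sqrt T.+1%:R.
  by apply: alE; rewrite -ltnS.
have := main _ rho2.
have -> : \sum_(t < T.+1) alpha t = gamma * Num.sqrt T.+1%:R.
  under eq_bigr do rewrite alE'.
  rewrite sumr_const card_ord -(mulr_natr (_ / _)) [X in _ * X = _]nE.
  by move: (Num.sqrt _) n0 => r r0; field; rewrite gt_eqF.
have -> : \sum_(t < T.+1) alpha t ^+ 2 = gamma ^+ 2.
  under eq_bigr do rewrite alE'.
  rewrite sumr_const card_ord -(mulr_natr (_ ^+ 2)) [X in _ * X = _]nE.
  by move: (Num.sqrt _) n0 => r r0; field; rewrite gt_eqF.
have -> : 2 * rho / (2 * rho - rho) / (gamma * Num.sqrt T.+1%:R) =
    2 / (gamma * Num.sqrt T.+1%:R).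
  by field; rewrite !gt_eqF//; lra.
by have -> : 2 * rho * L ^+ 2 / 2 * gamma ^+ 2 = rho * L ^+ 2 * gamma ^+ 2 by field.
Qed.
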